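(* Let $u$ be a solution of (P) for $p=1$ with kernel $K$ and data $(f,g)$, and $(u_n)$ a sequence of solutions of (P) for $p=1$ with kernels $K_n$ and data $(f_n,g_n)$. Assume $K,K_n$ are nonnegative, measurable and symmetric, $K,K_n\in L^{\infty,2}(\Omega^2)$, $g,g_n\in L^2(\Omega)$ and $f,f_n\in L^1([0,T];L^2(\Omega))$. Then: (i) $u$ and $u_n$ are the unique solutions of the corresponding evolution problems. (ii) $\|u_n-u\|_{C([0,T];L^2(\Omega))}\le\|g_n-g\|_{L^2(\Omega)}+\|f_n-f\|_{L^1([0,T];L^2(\Omega))}+T\|K_n-K\|_{L^2(\Omega^2)}$. (iii) Moreover, if $K_n\to K$ pointwise a.e. on $\Omega^2$, $g_n\to g$ pointwise a.e. on $\Omega$, $f_n\to f$ pointwise a.e. on $\Omega\times[0,T]$, and $(|K_n|^2)$ is uniformly integrable over $\Omega^2$, $(|g_n|^2)$ is uniformly integrable on $\Omega$ and $(|f_n|^2)$ is uniformly integrable on $\Omega\times[0,T]$, then $\lim_{n\to\infty}\|u_n-u\|_{C([0,T];L^2(\Omega))}=0$.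
   Context: $d\ge1$, $\Omega=[0,1]^d$, $T>0$. $\|F\|_{L^{\infty,2}(\Omega^2)}=\sup_{x}\|F(x,\cdot)\|_{L^2(\Omega)}$. Let $\partial|\cdot|(s)=\{1\}$ if $s>0$, $[-1,1]$ if $s=0$, $\{-1\}$ if $s<0$. The $1$-Laplacian: $\eta\in\Delta_1^Ku$ iff $\eta(x)=-\int_\Omega K(x,y)w(x,y)\,dy$ a.e. for some $w$ with $\|w\|_{L^\infty(\Omega^2)}\le1$, $w(x,y)=-w(y,x)$, $w(x,y)\in\partial|\cdot|(u(y)-u(x))$. A solution of (P) for $p=1$ with kernel $K$ and data $(f,g)$ on $[0,T]$ is $u\in C([0,T];L^1(\Omega))\cap W^{1,1}(]0,T[;L^1(\Omega))$ with $u(\cdot,0)=g$ a.e. and $\partial_tu=-\eta+f$ a.e. in $\Omega\times]0,T[$, where $\eta(\cdot,t)\in\Delta_1^Ku(\cdot,t)$. $\|u\|_{C([0,T];L^2)}=\sup_t\|u(\cdot,t)\|_{L^2}$; $\|f\|_{L^1([0,T];L^2)}=\int_0^T\|f(\cdot,t)\|_{L^2}dt$. *)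

(* Defs.v *)
From HB Require Import structures.
From mathcomp Require Import all_boot all_order all_algebra.
From mathcomp Require Import all_classical all_reals all_analysis.
Set Implicit Arguments. Unset Strict Implicit. Unset Printing Implicit Defensive.
Import Order.TTheory GRing.Theory Num.Theory.
Local Open Scope classical_set_scope.
Local Open Scope ring_scope.

Section sfprod.
Local Open Scope ereal_scope.
Local Open Scope classical_set_scope.
Context d1 d2 (T1 : measurableType d1) (T2 : measurableType d2) (R : realType).
Variable m1 : {sigma_finite_measure set T1 -> \bar R}%R.
Variable m2 : {sigma_finite_measure set T2 -> \bar R}%R.
Definition sfprod := (m1 \x m2).
HB.instance Definition _ := Measure.on sfprod.
Lemma sfprod_sigma_finite : sigma_finite setT sfprod.
Proof.
have /sigma_finiteP[F [TF ndF Foo]] := sigma_finiteT m1.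
have /sigma_finiteP[G [TG ndG Goo]] := sigma_finiteT m2.
exists (fun n => F n `*` G n).
 rewrite -setXTT TF TG predeqE => -[x y]; split.
    move=> [/= [n _ Fnx] [k _ Gky]]; exists (maxn n k) => //; split.
    - by move: x Fnx; exact/subsetPset/ndF/leq_maxl.
    - by move: y Gky; exact/subsetPset/ndG/leq_maxr.
  by move=> [n _ []/= ? ?]; split; exists n.
move=> k; have [? ?] := Foo k; have [? ?] := Goo k.
split; first exact: measurableX.
by rewrite /sfprod product_measure1E// lte_mul_pinfty// ge0_fin_numE.
Qed.
HB.instance Definition _ := Measure_isSigmaFinite.Build _ _ _ sfprod
  sfprod_sigma_finite.
End sfprod.

Record mspace (R : realType) := MSpace {
  md : measure_display;
  mT : measurableType md;
  mm : {sigma_finite_measure set mT -> \bar R} }.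

Fixpoint leb_space (R : realType) (n : nat) : mspace R :=
  match n with
  | 0%N => @MSpace R _ _ (@lebesgue_measure R)
  | k.+1 => let s := leb_space R k in
      @MSpace R _ _ (sfprod (@lebesgue_measure R) (mm s))
  end.

Fixpoint cube (R : realType) (n : nat) : set (mT (leb_space R n)) :=
  match n return set (mT (leb_space R n)) with
  | 0%N => `[0%R, 1%R]
  | k.+1 => `[0%R, 1%R] `*` @cube R k
  end.

(** The d-dimensional Lebesgue measure space R^d (d >= 1), built as the
    iterated product R * (R * ( ... * R)) of 1-dimensional Lebesgue
    measures, and the unit cube Omega = [0,1]^d inside it. *)
Definition Rd (R : realType) (d : nat) : measurableType (md (leb_space R d.-1)) :=
  mT (leb_space R d.-1).
Definition lebd (R : realType) (d : nat) :
  {sigma_finite_measure set (@Rd R d) -> \bar R} := mm (leb_space R d.-1).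
Definition Omega (R : realType) (d : nat) : set (@Rd R d) := @cube R d.-1.

Section problem.
Variables (R : realType) (d : nat).
Local Notation X := (@Rd R d).
Local Notation mu := (@lebd R d).
Local Notation Om := (@Omega R d).
Local Notation leb := (@lebesgue_measure R).
Local Open Scope ereal_scope.
Local Open Scope classical_set_scope.

Definition dabs (s : R) : set R :=
  if (0 < s)%R then [set 1%R] else if (s < 0)%R then [set (-1)%R]
  else `[(-1)%R, 1%R].

Definition one_laplacian (K : X -> X -> R) (u eta : X -> R) : Prop :=
  exists w : X -> X -> R,
    [/\ measurable_fun (Om `*` Om) (fun p => w p.1 p.2),
        {ae (mu \x mu), forall p, (Om `*` Om) p -> (`|w p.1 p.2| <= 1)%R},
        {ae (mu \x mu), forall p, (Om `*` Om) p -> w p.1 p.2 = (- w p.2 p.1)%R},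
        {ae (mu \x mu), forall p, (Om `*` Om) p ->
            dabs (u p.2 - u p.1)%R (w p.1 p.2)} &
        {ae mu, forall x, Om x ->
            (eta x)%:E = - \int[mu]_(y in Om) (K x y * w x y)%:E}].

Definition solution1 (K : X -> X -> R) (f : X -> R -> R) (g : X -> R)
    (T : R) (u : X -> R -> R) : Prop :=
  [/\
      (forall t, `[0%R, T] t -> mu.-integrable Om (fun x => (u x t)%:E)),
      (forall t, `[0%R, T] t -> forall e : R, (0 < e)%R ->
         exists2 del : R, (0 < del)%R & forall s, `[0%R, T] s ->
           (`|s - t| < del)%R ->
           \int[mu]_(x in Om) (`|u x s - u x t|)%:E < e%:E),
      {ae mu, forall x, Om x -> u x 0%R = g x} &
      (* u \in W^{1,1}(]0,T[; L^1(Omega)) with time derivative v, and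
         v = - eta + f a.e. in Omega x ]0,T[ with eta(.,t) \in Delta_1^K u(.,t) *)
      exists v eta : X -> R -> R,
      [/\ (mu \x leb).-integrable (Om `*` `]0%R, T[) (fun p => (v p.1 p.2)%:E),
          (forall t, `[0%R, T] t -> {ae mu, forall x, Om x ->
             (u x t)%:E = (u x 0%R)%:E + \int[leb]_(s in `[0%R, t]) (v x s)%:E}),
          {ae leb, forall t, `]0%R, T[ t ->
             one_laplacian K (fun x => u x t) (fun x => eta x t)} &
          {ae (mu \x leb), forall p, (Om `*` `]0%R, T[) p ->
             v p.1 p.2 = (- eta p.1 p.2 + f p.1 p.2)%R}]].

Definition L2norm (h : X -> R) : \bar R :=
  (\int[mu]_(x in Om) ((h x) ^+ 2)%:E) `^ (2^-1)%R.
Definition L2norm2 (F : X -> X -> R) : \bar R :=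
  (\int[mu \x mu]_(p in Om `*` Om) ((F p.1 p.2) ^+ 2)%:E) `^ (2^-1)%R.
Definition CL2norm (T : R) (w : X -> R -> R) : \bar R :=
  ereal_sup [set L2norm (fun x => w x t) | t in `[0%R, T]].
Definition L1L2norm (T : R) (f : X -> R -> R) : \bar R :=
  \int[leb]_(t in `[0%R, T]) L2norm (fun x => f x t).

Definition admissible_kernel (K : X -> X -> R) : Prop :=
  [/\ measurable_fun (Om `*` Om) (fun p => K p.1 p.2),
      (forall x y, Om x -> Om y -> (0 <= K x y)%R),
      (forall x y, Om x -> Om y -> K x y = K y x) &
      (* K \in L^{oo,2}(Omega^2) *)
      exists C : R, forall x, Om x -> \int[mu]_(y in Om) ((K x y) ^+ 2)%:E <= C%:E].

Definition in_L2 (g : X -> R) : Prop :=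
  measurable_fun Om g /\ mu.-integrable Om (fun x => ((g x) ^+ 2)%:E).

Definition in_L1L2 (T : R) (f : X -> R -> R) : Prop :=
  measurable_fun (Om `*` `[0%R, T]) (fun p => f p.1 p.2) /\
  L1L2norm T f < +oo.

End problem.

Definition unif_integrable d' (T : measurableType d') (R : realType)
    (m : set T -> \bar R) (D : set T) (h : nat -> T -> R) : Prop :=
  forall e : R, (0 < e)%R -> exists2 del : R, (0 < del)%R &
    forall n (A : set T), measurable A -> A `<=` D -> (m A < del%:E)%E ->
      (\int[m]_(x in A) (`|h n x|)%:E < e%:E)%E.

(* Main.v *)
Require Import Defs.
From HB Require Import structures.
From mathcomp Require Import all_boot all_order all_algebra.
From mathcomp Require Import all_classical all_reals all_analysis.
From mathcomp Require Import measurable_realfun ring lra.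
Import Order.TTheory GRing.Theory Num.Theory.
Import numFieldNormedType.Exports.
Local Open Scope ring_scope.
Local Open Scope ereal_scope.
Local Open Scope classical_set_scope.

(** Let z = u1 - u2 be the difference of two solutions and q its time
    derivative. Since K <= 1 + K^2, the nonlocal terms are bounded, so
    q(., r) lies in L^2 with norm at most b(r) for some integrable b, and
    Minkowski's integral inequality gives ||z(t) - z(s)|| <= B := int_s^t b.

    Monotonicity of the 1-Laplacian (antisymmetry of w and monotonicity of the
    subdifferential of the absolute value) gives <z(r), q(r)> <= ||z(r)|| a(r)
    with a(r) = ||f1(r) - f2(r)|| + ||K1 - K2||. Writing
    ||z(t)||^2 = <z(t), z(s)> + int_s^t <z(t), q(r)> dr and replacing z(t) by
    z(r) inside the integral yields
    ||z(t)||^2 <= ||z(t)|| ||z(s)|| + ||z(t)|| int_s^t a + 2 B^2;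
    working with the fixed function z(t) avoids any joint measurability of z.
    The error is quadratic in the increment of an absolutely continuous
    function, so subdividing [0, t] removes it and
    ||z(t)|| <= ||z(0)|| + int_0^t a. Uniqueness and stability follow;
    convergence follows by Vitali's theorem (Egorov and Fatou). *)

(** * Fubini on rectangles *)

(** The obstacle is that a solution is a family of time slices: u(., t) is tied to its derivative
    only for almost every x, with an exceptional set that may depend on t, and it is only assumed to
    be integrable in x. The factor 2 in the error collects two replacements of z(t) by z(r): one in
    the norm, ||z(r)|| <= ||z(t)|| + B, and one in the pairing, <z(t) - z(r), q(r)> <= B b(r). Since
    ||z(t)|| may vanish, the inequality is not divided by it directly: the subdivision is run on the
    maximum of ||z(t)|| and a positive floor, which is then sent to 0. The crude kernel bounds enter
    b only, hence only the quadratic error; the final bound sees a alone, which is why T ||K_n - K||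
    appears with coefficient one. *)

Section rectangle.
Context {d1 d2 : measure_display} {T1 : measurableType d1}
  {T2 : measurableType d2} {R : realType}.
Variables (m1 : {sigma_finite_measure set T1 -> \bar R})
  (m2 : {sigma_finite_measure set T2 -> \bar R}).
Variables (A : set T1) (B : set T2) (mA : measurable A) (mB : measurable B).
Implicit Type f : T1 * T2 -> \bar R.

Let mAB : measurable (A `*` B). Proof. exact: measurableX. Qed.

(** Extension by zero outside the rectangle turns the iterated integral over [A] and [B] into one
    over the whole product, where the Fubini and Tonelli theorems apply. *)
Let patch_x f : (fun x => \int[m2]_y (f \_ (A `*` B)) (x, y)) =
  (fun x => \int[m2]_(y in B) f (x, y)) \_ A.
Proof.
apply/funext => x; rewrite [RHS]patchE; case: ifPn => xA.
  rewrite [RHS]integral_mkcond; apply: eq_integral => y _.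
  by rewrite !patchE in_setX xA.
by apply: integral0_eq => y _; rewrite patchE in_setX (negbTE xA).
Qed.

Let patch_y f : (fun y => \int[m1]_x (f \_ (A `*` B)) (x, y)) =
  (fun y => \int[m1]_(x in A) f (x, y)) \_ B.
Proof.
apply/funext => y; rewrite [RHS]patchE; case: ifPn => yB.
  rewrite [RHS]integral_mkcond; apply: eq_integral => x _.
  by rewrite !patchE in_setX yB andbT.
by apply: integral0_eq => x _; rewrite patchE in_setX (negbTE yB) andbF.
Qed.

Let patch_measurable f : measurable_fun (A `*` B) f ->
  measurable_fun setT (f \_ (A `*` B)).
Proof. by move=> mf; apply/(measurable_restrict _ mAB measurableT); rewrite setTI. Qed.

Let patch_ge0 f : (forall p, (A `*` B) p -> 0 <= f p) ->
  forall p, 0 <= (f \_ (A `*` B)) p.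
Proof. by move=> f0 p; rewrite patchE; case: ifPn => //; rewrite inE => /f0. Qed.

Lemma measurable_fun_pair1_rect d' (U : measurableType d') (f : T1 * T2 -> U) x :
  measurable_fun (A `*` B) f -> A x -> measurable_fun B (fun y => f (x, y)).
Proof.
move=> mf Ax _ Y mY.
have := measurable_xsection x (mf mAB Y mY).
congr (measurable _); apply/seteqP; split => y; rewrite /xsection/= inE/=.
  by move=> [[_ By] Yf]; split.
by move=> [By Yf].
Qed.

Lemma measurable_fun_pair2_rect d' (U : measurableType d') (f : T1 * T2 -> U) y :
  measurable_fun (A `*` B) f -> B y -> measurable_fun A (fun x => f (x, y)).
Proof.
move=> mf By _ Y mY.
have := measurable_ysection y (mf mAB Y mY).
congr (measurable _); apply/seteqP; split => x; rewrite /ysection/= inE/=.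
  by move=> [[Ax _] Yf]; split.
by move=> [Ax Yf].
Qed.

Section nonneg.
Variable f : T1 * T2 -> \bar R.
Hypotheses (mf : measurable_fun (A `*` B) f)
  (f0 : forall p, (A `*` B) p -> 0 <= f p).

Lemma tonelli_rect1 : \int[m1 \x m2]_(p in A `*` B) f p =
  \int[m1]_(x in A) \int[m2]_(y in B) f (x, y).
Proof.
rewrite integral_mkcond fubini_tonelli1; last 2 first.
- exact: patch_measurable.
- exact: patch_ge0.
by rewrite /fubini_F patch_x -integral_mkcond.
Qed.

Lemma tonelli_rect2 : \int[m1 \x m2]_(p in A `*` B) f p =
  \int[m2]_(y in B) \int[m1]_(x in A) f (x, y).
Proof.
rewrite integral_mkcond fubini_tonelli2; last 2 first.
- exact: patch_measurable.
- exact: patch_ge0.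
by rewrite /fubini_G patch_y -integral_mkcond.
Qed.

Lemma measurable_tonelli_rect1 :
  measurable_fun A (fun x => \int[m2]_(y in B) f (x, y)).
Proof.
have := @measurable_fun_fubini_tonelli_F _ _ _ _ _ m2 _
  (patch_measurable _ mf) (patch_ge0 _ f0).
rewrite /fubini_F patch_x => h.
by have /(measurable_restrict _ mA measurableT) := h; rewrite setTI.
Qed.

Lemma measurable_tonelli_rect2 :
  measurable_fun B (fun y => \int[m1]_(x in A) f (x, y)).
Proof.
have := @measurable_fun_fubini_tonelli_G _ _ _ _ _ m1 _
  (patch_measurable _ mf) (patch_ge0 _ f0).
rewrite /fubini_G patch_y => h.
by have /(measurable_restrict _ mB measurableT) := h; rewrite setTI.
Qed.
End nonneg.

Section integrable.
Variable f : T1 * T2 -> \bar R.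
Hypothesis intf : (m1 \x m2).-integrable (A `*` B) f.

Let intf' : (m1 \x m2).-integrable setT (f \_ (A `*` B)).
Proof. exact/(integrable_mkcond _ mAB). Qed.

Lemma fubini_rect1 : \int[m1 \x m2]_(p in A `*` B) f p =
  \int[m1]_(x in A) \int[m2]_(y in B) f (x, y).
Proof.
by rewrite integral_mkcond -(integral12_prod_meas1 intf') /fubini_F patch_x -integral_mkcond.
Qed.

Lemma fubini_rect2 : \int[m1 \x m2]_(p in A `*` B) f p =
  \int[m2]_(y in B) \int[m1]_(x in A) f (x, y).
Proof.
by rewrite integral_mkcond -(integral21_prod_meas1 intf') /fubini_G patch_y -integral_mkcond.
Qed.

Lemma integrable_fubini_rect1 :
  m1.-integrable A (fun x => \int[m2]_(y in B) f (x, y)).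
Proof.
apply/(integrable_mkcond _ mA); rewrite -patch_x.
exact: (integrable_fubini_F intf').
Qed.

Lemma integrable_fubini_rect2 :
  m2.-integrable B (fun y => \int[m1]_(x in A) f (x, y)).
Proof.
apply/(integrable_mkcond _ mB); rewrite -patch_y.
have mf' : measurable_fun setT (f \_ (A `*` B)) := measurable_int _ intf'.
(* The modulus of the inner integral is at most the inner integral of the modulus, whose outer
   integral is finite because f is integrable on the product. *)
apply/integrableP; split; first exact: (measurable_fubini_G intf').
have /integrable21ltyP -/(_ mf') h := intf'.
apply: le_lt_trans h.
have msec y : measurable_fun setT (fun x => (f \_ (A `*` B)) (x, y)).
  exact: measurableT_comp.
apply: ge0_le_integral => //.
- by apply: measurableT_comp => //; exact: (measurable_fubini_G intf').
- apply: (@measurable_fun_fubini_tonelli_G _ _ _ _ _ m1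
    (abse \o (f \_ (A `*` B)))).
    exact: measurableT_comp.
  by move=> p; exact: abse_ge0.
by move=> y _; exact: le_abse_integral.
Qed.

Lemma ae_integrable_rect1 :
  {ae m1, forall x, A x -> m2.-integrable B (fun y => f (x, y))}.
Proof.
have := ae_integrable1 intf'; apply: filterS => x /= h Ax.
apply/(integrable_mkcond _ mB); apply: eq_integrable h => // y _.
by rewrite !patchE in_setX mem_set.
Qed.

End integrable.

Lemma integrable_rect21 f : measurable_fun (A `*` B) f ->
  \int[m2]_(y in B) \int[m1]_(x in A) `|f (x, y)| < +oo ->
  (m1 \x m2).-integrable (A `*` B) f.
Proof.
move=> mf h; apply/integrableP; split => //; rewrite tonelli_rect2//.
by apply: measurableT_comp.
Qed.

(** A null set of the product has null sections at almost every x, because the measures of its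
    x-sections integrate to 0. *)
Lemma ae_rect1 (P : T1 * T2 -> Prop) :
  {ae m1 \x m2, forall p, (A `*` B) p -> P p} ->
  {ae m1, forall x, A x -> {ae m2, forall y, B y -> P (x, y)}}.
Proof.
move=> [N [mN N0 sN]].
have mNx : measurable_fun setT (m2 \o xsection N).
  exact: measurable_fun_xsection.
have : \int[m1]_x `|m2 (xsection N x)| = 0.
  by rewrite -N0; apply: eq_integral => x _; rewrite gee0_abs.
move/(ae_eq_integral_abs m1 measurableT mNx); apply: filterS => x /= /(_ I) x0 Ax.
exists (xsection N x); split => //; first exact: measurable_xsection.
move=> y /= /not_implyP[By nP]; rewrite /xsection/= inE; apply: sN => /=.
by apply/not_implyP; split.
Qed.

(** The product measure is defined through x-sections, so the measure of a y-section is recovered as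
    an integral of the indicator of the null set, and Tonelli shows that these integrate to 0. *)
Lemma ae_rect2 (P : T1 * T2 -> Prop) :
  {ae m1 \x m2, forall p, (A `*` B) p -> P p} ->
  {ae m2, forall y, B y -> {ae m1, forall x, A x -> P (x, y)}}.
Proof.
move=> [N [mN N0 sN]].
have mNy : measurable_fun setT (fun y => \int[m1]_x (\1_N (x, y))%:E).
  apply: (@measurable_fun_fubini_tonelli_G _ _ _ _ _ m1 (EFin \o \1_N)).
    by apply/measurable_EFinP; exact: measurable_indic.
  by move=> p; rewrite /= lee_fin.
have : \int[m2]_y \int[m1]_x (\1_N (x, y))%:E = 0.
  rewrite -(fubini_tonelli2 (EFin \o \1_N))//=; last first.
    by apply/measurable_EFinP; exact: measurable_indic.
  by rewrite integral_indic// setIT.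
rewrite (eq_integral (fun y => `|\int[m1]_x (\1_N (x, y))%:E|)); last first.
  by move=> y _; rewrite gee0_abs//; apply: integral_ge0.
move/(ae_eq_integral_abs m2 measurableT mNy); apply: filterS => y /= /(_ I) y0 By.
exists (ysection N y); split; first exact: measurable_ysection.
  rewrite -y0 -[ysection N y]setIT -integral_indic//; last first.
    exact: measurable_ysection.
  apply: eq_integral => x _.
  by rewrite !indicE mem_ysection.
move=> x /= /not_implyP[Ax nP]; rewrite /ysection/= inE; apply: sN => /=.
by apply/not_implyP; split.
Qed.

End rectangle.

(** * Exchange of the two variables on a square *)

Section swap.
Context {d : measure_display} {X : measurableType d} {R : realType}.
Variables (mu : {sigma_finite_measure set X -> \bar R}).
Variables (A : set X) (mA : measurable A) (F : X * X -> \bar R).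
Hypothesis intF : (mu \x mu).-integrable (A `*` A) F.

Let mAA : measurable (A `*` A). Proof. exact: measurableX. Qed.

(** Iterating the integral of the modulus in opposite orders for F and for its transpose produces
    the same double integral. *)
Lemma integrable_swap :
  (mu \x mu).-integrable (A `*` A) (fun p => F (p.2, p.1)).
Proof.
have /integrableP[mF iF] := intF.
have mF' : measurable_fun (A `*` A) (fun p => F (p.2, p.1)).
  rewrite [X in measurable_fun _ X](_ : _ = F \o unstable.swap)//.
  apply: (measurable_comp mAA _ mF); first by move=> _ [[x y] [Ax Ay] <-].
  by apply: measurable_funTS; exact: measurable_swap.
apply/integrableP; split => //; rewrite tonelli_rect2//; last first.
  by apply: measurableT_comp.
by rewrite tonelli_rect1// in iF; apply: measurableT_comp.
Qed.

Lemma integral_swap : \int[mu \x mu]_(p in A `*` A) F (p.2, p.1) =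
  \int[mu \x mu]_(p in A `*` A) F p.
Proof.
rewrite (fubini_rect2 mu mu A A mA mA _ integrable_swap).
by rewrite (fubini_rect1 mu mu A A mA mA _ intF).
Qed.

End swap.

(** * Square-integrable functions *)

Section almost_everywhere_integral.
Context {d : measure_display} {X : measurableType d} {R : realType}.
Variables (mu : {measure set X -> \bar R}) (D : set X) (mD : measurable D).
Implicit Types f g h : X -> R.

Lemma ae_le_integrable f g : measurable_fun D f ->
  {ae mu, forall x, D x -> (`|f x| <= g x)%R} ->
  mu.-integrable D (EFin \o g) -> mu.-integrable D (EFin \o f).
Proof.
move=> mf fg /integrableP[mg ig]; apply/integrableP.
split; first exact/measurable_EFinP.
apply: le_lt_trans ig; apply: ae_ge0_le_integral => //.
- by apply: measurableT_comp => //; exact/measurable_EFinP.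
- by apply: measurableT_comp.
apply: filterS fg => x fg Dx; rewrite /= lee_fin.
by apply: le_trans (fg Dx) _; exact: ler_norm.
Qed.

Lemma ae_le_integral (f g : X -> \bar R) :
  mu.-integrable D f -> mu.-integrable D g ->
  {ae mu, forall x, D x -> f x <= g x} ->
  \int[mu]_(x in D) f x <= \int[mu]_(x in D) g x.
Proof.
move=> fi gi [N [mN N0 sN]].
rewrite (negligible_integral mN mD fi N0) (negligible_integral mN mD gi N0).
have mDN : measurable (D `\` N) by exact: measurableD.
apply: le_integral => //.
- by apply: integrableS fi.
- by apply: integrableS gi.
move=> x; rewrite inE => -[Dx nN]; apply: contrapT => h; apply: nN; apply: sN => /=.
by apply/not_implyP; split.
Qed.

Lemma ae_le_Rintegral f g :
  mu.-integrable D (EFin \o f) -> mu.-integrable D (EFin \o g) ->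
  {ae mu, forall x, D x -> (f x <= g x)%R} ->
  (\int[mu]_(x in D) f x <= \int[mu]_(x in D) g x)%R.
Proof.
move=> fi gi fg; rewrite fine_le ?integrable_fin_num//.
by apply: ae_le_integral => //; apply: filterS fg => x fg /fg; rewrite lee_fin.
Qed.

Lemma ae_eq_Rintegral f g : measurable_fun D f -> measurable_fun D g ->
  {ae mu, forall x, D x -> f x = g x} ->
  (\int[mu]_(x in D) f x = \int[mu]_(x in D) g x)%R.
Proof.
move=> mf mg fg; congr fine; apply: ae_eq_integral => //.
- exact/measurable_EFinP.
- exact/measurable_EFinP.
by apply: filterS fg => x fg Dx; rewrite fg.
Qed.

Lemma integrable_EFinK f : mu.-integrable D (EFin \o f) ->
  \int[mu]_(x in D) (f x)%:E = (\int[mu]_(x in D) f x)%R%:E.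
Proof. by move=> fi; rewrite /Rintegral fineK//; exact: integrable_fin_num. Qed.

End almost_everywhere_integral.

Lemma ler_sqr_normr (R : realDomainType) (x y : R) :
  (`|x| <= `|y| -> x ^+ 2 <= y ^+ 2)%R.
Proof.
move=> xy; rewrite -(real_normK (num_real x)) -(real_normK (num_real y)).
by rewrite lerXn2r ?nnegrE.
Qed.

Section square_integrable.
Local Open Scope ring_scope.
Context {d : measure_display} {X : measurableType d} {R : realType}.
Variables (mu : {measure set X -> \bar R}) (D : set X).

(** Convertible to [in_L2] on the cube, but stated for any measure and set so that it also serves
    the square of the cube. *)
Definition sq_integrable (f : X -> R) : Prop :=
  measurable_fun D f /\ mu.-integrable D (fun x => (f x ^+ 2)%:E).

Definition inner (f g : X -> R) : R := \int[mu]_(x in D) (f x * g x).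

(** Real-valued, hence meaningful only together with [sq_integrable]: a divergent integral is read
    as 0. [norm2E] gives the link with the extended-real norms of the statement. *)
Definition norm2 (f : X -> R) : R := Num.sqrt (inner f f).

Hypothesis mD : measurable D.
Implicit Types f g h : X -> R.

Lemma sq_integrableM f g : sq_integrable f -> sq_integrable g ->
  mu.-integrable D (EFin \o (fun x => f x * g x)).
Proof.
move=> [mf If] [mg Ig].
apply: (@ae_le_integrable _ _ _ mu D mD _ (fun x => f x ^+ 2 + g x ^+ 2)).
- exact: measurable_funM.
- apply: aeW => x _; rewrite normrM.
  rewrite -(real_normK (num_real (f x))) -(real_normK (num_real (g x))).
  by nra.
- exact: (integrableD mD If Ig).
Qed.

Lemma sq_integrableD f g : sq_integrable f -> sq_integrable g ->
  sq_integrable (fun x => f x + g x).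
Proof.
move=> [mf If] [mg Ig]; split; first exact: measurable_funD.
apply: (@ae_le_integrable _ _ _ mu D mD (fun x => (f x + g x) ^+ 2)
  (fun x => 2 * (f x ^+ 2 + g x ^+ 2))).
- by apply: measurable_funX; exact: measurable_funD.
- apply: aeW => x _; rewrite ger0_norm ?sqr_ge0//.
  have : 0 <= (f x - g x) ^+ 2 by rewrite sqr_ge0.
  by rewrite !expr2; nra.
- exact: (integrableZl mD 2 (integrableD mD If Ig)).
Qed.

Lemma sq_integrableZ k f : sq_integrable f -> sq_integrable (fun x => k * f x).
Proof.
move=> [mf If]; split; first exact: measurable_funM.
apply: eq_integrable (integrableZl mD (k ^+ 2) If) => // x _.
by rewrite exprMn EFinM.
Qed.

Lemma sq_integrableB f g : sq_integrable f -> sq_integrable g ->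
  sq_integrable (fun x => f x - g x).
Proof.
move=> If Ig.
have := sq_integrableD _ _ If (sq_integrableZ (-1) _ Ig).
by under eq_fun do rewrite mulN1r.
Qed.

Lemma sq_integrable_cst k : (mu D < +oo)%E -> sq_integrable (cst k).
Proof.
move=> muD; split => //; apply/integrableP; split => //=.
rewrite (_ : (fun _ => _) = cst (`|k ^+ 2|%:E))// integral_cst//.
by rewrite lte_mul_pinfty.
Qed.

Lemma ae_le_sq_integrable f g : measurable_fun D f -> sq_integrable g ->
  {ae mu, forall x, D x -> `|f x| <= `|g x|} -> sq_integrable f.
Proof.
move=> mf [mg Ig] fg; split => //.
apply: (@ae_le_integrable _ _ _ mu D mD (fun x => f x ^+ 2)
  (fun x => g x ^+ 2)) => //; first exact: measurable_funX.
apply: filterS fg => x fg Dx; rewrite ger0_norm ?sqr_ge0//.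
by rewrite ler_sqr_normr// fg.
Qed.

Lemma innerC f g : inner f g = inner g f.
Proof. by apply: eq_Rintegral => x _; rewrite mulrC. Qed.

Lemma inner_ge0 f : 0 <= inner f f.
Proof. by apply: Rintegral_ge0 => x _; rewrite -expr2 sqr_ge0. Qed.

Lemma innerDl f g h : sq_integrable f -> sq_integrable g -> sq_integrable h ->
  inner (fun x => f x + g x) h = inner f h + inner g h.
Proof.
move=> If Ig Ih; rewrite -RintegralD//; try exact: sq_integrableM.
by apply: eq_Rintegral => x _; rewrite mulrDl.
Qed.

Lemma innerZl k f g : sq_integrable f -> sq_integrable g ->
  inner (fun x => k * f x) g = k * inner f g.
Proof.
move=> If Ig; rewrite -RintegralZl//; try exact: sq_integrableM.
by apply: eq_Rintegral => x _; rewrite mulrA.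
Qed.

Lemma innerBl f g h : sq_integrable f -> sq_integrable g -> sq_integrable h ->
  inner (fun x => f x - g x) h = inner f h - inner g h.
Proof.
move=> If Ig Ih; rewrite -RintegralB//; try exact: sq_integrableM.
by apply: eq_Rintegral => x _; rewrite mulrBl.
Qed.

Lemma innerDr f g h : sq_integrable f -> sq_integrable g -> sq_integrable h ->
  inner h (fun x => f x + g x) = inner h f + inner h g.
Proof. by move=> If Ig Ih; rewrite innerC innerDl// !(innerC h). Qed.

Lemma innerBr f g h : sq_integrable f -> sq_integrable g -> sq_integrable h ->
  inner h (fun x => f x - g x) = inner h f - inner h g.
Proof. by move=> If Ig Ih; rewrite innerC innerBl// !(innerC h). Qed.

Lemma innerZr k f g : sq_integrable f -> sq_integrable g ->
  inner g (fun x => k * f x) = k * inner g f.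
Proof. by move=> If Ig; rewrite innerC innerZl// innerC. Qed.

Lemma ae_eq_inner f f' g g' : measurable_fun D f -> measurable_fun D f' ->
  measurable_fun D g -> measurable_fun D g' ->
  {ae mu, forall x, D x -> f x = f' x} -> {ae mu, forall x, D x -> g x = g' x} ->
  inner f g = inner f' g'.
Proof.
move=> mf mf' mg mg' ff' gg'; apply: ae_eq_Rintegral => //.
- exact: measurable_funM.
- exact: measurable_funM.
by apply: filterS2 ff' gg' => x ff' gg' Dx; rewrite ff'// gg'.
Qed.

Lemma norm2_ge0 f : 0 <= norm2 f. Proof. exact: sqrtr_ge0. Qed.

Lemma norm2_sqr f : norm2 f ^+ 2 = inner f f.
Proof. by rewrite sqr_sqrtr// inner_ge0. Qed.

Lemma cauchy_schwarz_inner f g : sq_integrable f -> sq_integrable g ->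
  inner f g <= norm2 f * norm2 g.
Proof.
move=> If Ig.
have p t : 0 <= t ^+ 2 * inner f f - 2 * t * inner f g + inner g g.
  have := inner_ge0 (fun x => t * f x - g x).
  have Itf := sq_integrableZ t _ If.
  rewrite innerBl//; last exact: sq_integrableB.
  rewrite !innerBr// !innerZl// !innerZr// (innerC g f).
  move/le_trans; apply; rewrite le_eqVlt; apply/orP; left; apply/eqP; ring.
have [g0|g0] := lerP (inner f g) 0.
  by apply: le_trans g0 _; rewrite mulr_ge0// norm2_ge0.
rewrite /norm2 -sqrtrM ?inner_ge0//.
suff : inner f g ^+ 2 <= inner f f * inner g g.
  move=> h; rewrite -(ger0_norm (ltW g0)) -sqrtr_sqr ler_sqrt//.
  by rewrite mulr_ge0// inner_ge0.
have := inner_ge0 f; rewrite le_eqVlt => /predU1P[f0|f0].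
  (* With <f, f> = 0 the quadratic is affine in t, and this t gives it the value -1, a
     contradiction. *)
  have := p ((inner g g + 1) / (2 * inner f g)); rewrite -f0 mulr0.
  have -> : 2 * ((inner g g + 1) / (2 * inner f g)) * inner f g = inner g g + 1.
    by field; rewrite gt_eqF.
  by lra.
(* The minimiser of the quadratic. *)
have := p (inner f g / inner f f).
have -> : (inner f g / inner f f) ^+ 2 * inner f f -
  2 * (inner f g / inner f f) * inner f g + inner g g =
  inner g g - inner f g ^+ 2 / inner f f.
  by field; rewrite gt_eqF.
by rewrite subr_ge0 ler_pdivrMr// mulrC.
Qed.

Lemma norm2D f g : sq_integrable f -> sq_integrable g ->
  norm2 (fun x => f x + g x) <= norm2 f + norm2 g.
Proof.
move=> If Ig.
rewrite -(@ler_pXn2r _ 2)// ?nnegrE ?addr_ge0 ?norm2_ge0//.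
rewrite norm2_sqr innerDl//; last exact: sq_integrableD.
rewrite !innerDr// (innerC g) sqrrD !norm2_sqr.
have := cauchy_schwarz_inner _ _ If Ig.
by rewrite -mulr_natl; lra.
Qed.

Lemma norm2Z k f : sq_integrable f -> norm2 (fun x => k * f x) = `|k| * norm2 f.
Proof.
move=> If; rewrite /norm2 innerZl//; last exact: sq_integrableZ.
rewrite innerC innerZl// mulrA -expr2 sqrtrM ?sqr_ge0//.
by rewrite sqrtr_sqr.
Qed.

Lemma norm2B f g : sq_integrable f -> sq_integrable g ->
  norm2 (fun x => f x - g x) <= norm2 f + norm2 g.
Proof.
move=> If Ig.
have := norm2D _ _ If (sq_integrableZ (-1) _ Ig).
by rewrite norm2Z// normrN1 mul1r; under eq_fun do rewrite mulN1r.
Qed.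

Lemma ae_le_norm2 f g : measurable_fun D f -> sq_integrable g ->
  {ae mu, forall x, D x -> `|f x| <= `|g x|} -> norm2 f <= norm2 g.
Proof.
move=> mf Ig fg; have If := ae_le_sq_integrable _ _ mf Ig fg.
rewrite ler_sqrt ?inner_ge0//; apply: ae_le_Rintegral => //.
- exact: sq_integrableM.
- exact: sq_integrableM.
by apply: filterS fg => x fg Dx; rewrite -!expr2 ler_sqr_normr// fg.
Qed.

Lemma integral_sqrE f : sq_integrable f ->
  (\int[mu]_(x in D) (f x ^+ 2)%:E)%E = (norm2 f ^+ 2)%:E.
Proof.
move=> [mf If]; rewrite norm2_sqr (@integrable_EFinK _ _ _ mu D mD)//.
Qed.

Lemma norm2E f : sq_integrable f ->
  ((\int[mu]_(x in D) (f x ^+ 2)%:E) `^ 2^-1 = (norm2 f)%:E)%E.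
Proof.
move=> If; rewrite integral_sqrE// poweR_EFin powR12_sqrt ?sqr_ge0//.
by rewrite sqrtr_sqr ger0_norm// norm2_ge0.
Qed.

Lemma sq_integrable_norm f : sq_integrable f -> sq_integrable (fun x => `|f x|).
Proof.
move=> If; apply: (ae_le_sq_integrable _ f) => //; last first.
  by apply: aeW => x _; rewrite normr_id.
by case: If => mf _; exact: measurableT_comp.
Qed.

(** Tonelli arguments need the pairing with absolute values and in the extended reals; this is
    Cauchy-Schwarz for |f| and |g|, whose norms are those of f and g. *)
Lemma integral_normM_le f g : sq_integrable f -> sq_integrable g ->
  (\int[mu]_(x in D) `|f x * g x|%:E <= (norm2 f * norm2 g)%:E)%E.
Proof.
move=> If Ig.
have If' := sq_integrable_norm _ If; have Ig' := sq_integrable_norm _ Ig.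
have nE h : norm2 h = norm2 (fun x => `|h x|).
  congr Num.sqrt; apply: eq_Rintegral => x _.
  by rewrite -!expr2 real_normK ?num_real.
rewrite (nE f) (nE g) (eq_integral (fun x => (`|f x| * `|g x|)%:E)).
  rewrite (integrable_EFinK _ _ mD _ (sq_integrableM _ _ If' Ig')) lee_fin.
  exact: cauchy_schwarz_inner.
by move=> x _; rewrite normrM.
Qed.

End square_integrable.

(** * Quadratic growth and Vitali convergence *)

Section quadratic_growth.
Local Open Scope ring_scope.
Context {R : realType}.
Variables (T : R) (N FA FB : R -> R).
Hypothesis N0_ge0 : 0 <= N 0.
Hypothesis FB_cont : {within `[0, T], continuous FB}.
Hypothesis FB_nd : forall s t, 0 <= s -> s <= t -> t <= T -> FB s <= FB t.
Hypothesis FA_nd : forall s t, 0 <= s -> s <= t -> t <= T -> FA s <= FA t.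
Hypothesis growth : forall s t, 0 <= s -> s <= t -> t <= T ->
  N t ^+ 2 <= N t * N s + N t * (FA t - FA s) + 2 * (FB t - FB s) ^+ 2.

(* Cutting [s, t] at the point that halves the increment of FB halves the
   total quadratic error, so iterating removes it. *)
Let growth_max (c : R) (k : nat) s t : 0 < c -> 0 <= s -> s <= t -> t <= T ->
  Num.max (N t) c <=
  Num.max (N s) c + (FA t - FA s) + 2 / c * (FB t - FB s) ^+ 2 / 2 ^+ k.
Proof.
move=> c0; elim: k s t => [|k IH] s t s0 st tT.
  rewrite expr0 divr1.
  have A0 : 0 <= FA t - FA s by rewrite subr_ge0 FA_nd.
  have E0 : 0 <= 2 / c * (FB t - FB s) ^+ 2.
    by rewrite mulr_ge0 ?sqr_ge0 ?divr_ge0// ltW.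
  have MsN : N s <= Num.max (N s) c by rewrite le_max lexx.
  have Msc : c <= Num.max (N s) c by rewrite le_max lexx orbT.
  (* Below the floor c the left side is c itself. Above it, the growth inequality can be divided by
     [N t], and the error is then multiplied by at most 1 / c. *)
  have [Ntc|cNt] := leP (N t) c; first by lra.
  have Nt0 : 0 < N t by exact: lt_trans cNt.
  have h := growth _ _ s0 st tT.
  have : N t <= N s + (FA t - FA s) + 2 * (FB t - FB s) ^+ 2 / N t.
    rewrite -(ler_pM2l Nt0) !mulrDr.
    have -> : N t * (2 * (FB t - FB s) ^+ 2 / N t) = 2 * (FB t - FB s) ^+ 2.
      by field; rewrite gt_eqF.
    by rewrite -mulrDr -expr2; lra.
  have : 2 * (FB t - FB s) ^+ 2 / N t <= 2 / c * (FB t - FB s) ^+ 2.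
    rewrite mulrAC ler_wpM2r ?sqr_ge0// ler_pM2l// lef_pV2 ?posrE//.
    exact: ltW.
  by lra.
have FBst := FB_nd _ _ s0 st tT.
have stT : `[s, t] `<=` `[0, T].
  by apply: subset_itv; rewrite bnd_simp.
have [|m + FBm] := @IVT R FB s t ((FB s + FB t) / 2) st
  (continuous_subspaceW stT FB_cont).
  by rewrite (min_idPl FBst) (max_idPr FBst); lra.
rewrite in_itv/= => /andP[sm mt].
have := IH s m s0 sm (le_trans mt tT).
have := IH m t (le_trans s0 sm) mt tT.
rewrite FBm [2 ^+ k.+1]exprS invfM.
set p := (2 ^+ k)^-1.
(* Each half sees half of the increment, hence a quarter of its square; the two together make half
   of the error. *)
have -> : 2 / c * (FB t - (FB s + FB t) / 2) ^+ 2 * p =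
  2 / c * (FB t - FB s) ^+ 2 * (2^-1 * p) / 2 by field; rewrite gt_eqF.
have -> : 2 / c * ((FB s + FB t) / 2 - FB s) ^+ 2 * p =
  2 / c * (FB t - FB s) ^+ 2 * (2^-1 * p) / 2 by field; rewrite gt_eqF.
by lra.
Qed.

Lemma quadratic_growth t : 0 <= t -> t <= T -> N t <= N 0 + (FA t - FA 0).
Proof.
move=> t0 tT; apply/ler_addgt0Pr => e e0.
(* The tolerance is split evenly between the floor c = e / 2 and the residual error x / 2^k. *)
have e20 : 0 < e / 2 by rewrite divr_gt0.
set x := 2 / (e / 2) * (FB t - FB 0) ^+ 2.
have x0 : 0 <= x by rewrite mulr_ge0 ?sqr_ge0 ?divr_ge0// ltW.
(* Any k above x / (e / 2) will do, since 2^k > k. *)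
pose k := (Num.truncn (x / (e / 2))).+1.
have := growth_max (e / 2) k 0 t e20 (lexx 0) t0 tT; rewrite -/x.
have xk : x / 2 ^+ k <= e / 2.
  rewrite ler_pdivrMr ?exprn_gt0// mulrC -ler_pdivrMr//.
  apply: (@le_trans _ _ k%:R); first by rewrite ltW// truncnS_gt.
  by rewrite -natrX ler_nat ltnW// ltn_expl.
have Nt : N t <= Num.max (N t) (e / 2) by rewrite le_max lexx.
have : Num.max (N 0) (e / 2) <= N 0 + e / 2.
  by rewrite ge_max lerDl ltW//= lerDr.
by lra.
Qed.

End quadratic_growth.

(** * Vitali convergence for squares *)

Section vitali.
Context {d : measure_display} {X : measurableType d} {R : realType}.
Variables (mu : {measure set X -> \bar R}) (D : set X) (mD : measurable D).
Variables (h : nat -> X -> R) (g : X -> R).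
Hypothesis muD : mu D < +oo.
Hypothesis mh : forall n, measurable_fun D (h n).
Hypothesis mg : measurable_fun D g.
Hypothesis hg : {ae mu, forall x, D x -> (fun n => h n x) @ \oo --> g x}.

Let sqr_measurable (A : set X) (k : X -> R) : measurable A -> A `<=` D ->
  measurable_fun D k -> measurable_fun A (fun x => (k x ^+ 2)%:E).
Proof.
move=> mA AD mk; apply/measurable_EFinP; apply: measurable_funX.
exact: measurable_funS mk.
Qed.

(** The bound is asked on every measurable subset of [A] because Fatou's lemma is applied on [A]
    minus the null set where convergence fails. *)
Let fatou_sqr (A : set X) (e : R) : measurable A -> A `<=` D ->
  (forall n B, measurable B -> B `<=` A ->
    \int[mu]_(x in B) (h n x ^+ 2)%:E <= e%:E) ->
  \int[mu]_(x in A) (g x ^+ 2)%:E <= e%:E.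
Proof.
move=> mA AD he; have [N [mN N0 sN]] := hg.
rewrite (ge0_negligible_integral mN mA)//; last 2 first.
- exact: sqr_measurable.
- by move=> x _; rewrite lee_fin sqr_ge0.
have mAN : measurable (A `\` N) by exact: measurableD.
have ANA : A `\` N `<=` A by exact: subDsetl.
have ANx x : (A `\` N) x -> (fun n => h n x) @ \oo --> g x.
  move=> [Ax nNx]; apply: contrapT => nc; apply: nNx; apply: sN => /=.
  by apply/not_implyP; split => //; exact: AD.
rewrite (eq_integral (fun x => limn_einf (fun n => (h n x ^+ 2)%:E))); last first.
  move=> x; rewrite inE => /ANx hx.
  have cx : (fun n => (h n x ^+ 2)%:E) @ \oo --> (g x ^+ 2)%:E.
    by apply: cvg_EFin; [exact: nearW|under eq_fun do rewrite /= expr2;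
      rewrite expr2; exact: cvgM].
  by rewrite is_cvg_limn_einfE; [rewrite (cvg_lim _ cx)|apply/cvg_ex; eexists; exact: cx].
apply: le_trans (fatou mu mAN _ _) _.
- by move=> n; apply: sqr_measurable => //; exact: subset_trans AD.
- by move=> n x _; rewrite lee_fin sqr_ge0.
rewrite limn_einf_lim; apply: lime_le; first exact: is_cvg_einfs.
apply: nearW => n; apply: le_trans (he n _ mAN ANA).
by apply: ereal_inf_lbound; exists n => /=.
Qed.

(** Off Egorov's small set the convergence is uniform and [D] has finite measure. On the small set
    uniform integrability controls the h_n^2, and Fatou passes the same bound on to g^2. *)
Lemma vitali_sqr : unif_integrable mu D (fun n x => (h n x ^+ 2)%R) ->
  forall e : R, (0 < e)%R ->
  \forall n \near \oo, \int[mu]_(x in D) ((h n x - g x) ^+ 2)%:E <= e%:E.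
Proof.
move=> ui e e0.
(* On the small set (h - g)^2 <= 2 h^2 + 2 g^2 <= 4 (e / 8) after integration, which is half of the
   tolerance. *)
have e80 : (0 < e / 8)%R by rewrite divr_gt0.
have [del del0 hdel] := ui _ e80.
have [B [mB muB hunif]] := ae_pointwise_almost_uniform mh mg mD muD hg del0.
pose A := D `&` B.
have mA : measurable A by exact: measurableI.
have AD : A `<=` D by exact: subIsetl.
have hA n C : measurable C -> C `<=` A ->
    \int[mu]_(x in C) (h n x ^+ 2)%:E <= (e / 8)%:E.
  move=> mC CA; have := hdel n C mC (subset_trans CA AD) _.
  under eq_integral do rewrite ger0_norm ?sqr_ge0//.
  move=> H; apply/ltW/H; apply: le_lt_trans muB.
  by apply: le_measure; rewrite ?inE//; apply: subset_trans CA _; exact: subIsetr.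
have gA := fatou_sqr A (e / 8) mA AD hA.
(* The 1 keeps m positive when [D] is null. With eps <= 1 the square eps^2 is at most eps, and eps *
   m <= e / 2 is the other half of the tolerance. *)
pose m := (fine (mu D) + 1)%R.
have m1 : (1 <= m)%R by rewrite lerDr fine_ge0.
pose eps := Num.min 1%R (e / (2 * m))%R.
have em0 : (0 < e / (2 * m))%R by rewrite divr_gt0// mulr_gt0// (lt_le_trans _ m1).
have eps0 : (0 < eps)%R by rewrite lt_min ltr01.
have nb : nbhs (g : {uniform` (D `\` B) -> R^o})
    [set k | forall x, (D `\` B) x -> (`|g x - k x| < eps)%R].
  apply/uniform_nbhs; exists [set xy | (`|xy.1 - xy.2| < eps)%R]; split => //.
  exact: (entourage_ball R^o (PosNum eps0)).
have : \forall n \near \oo, forall x, (D `\` B) x -> (`|g x - h n x| < eps)%R.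
  exact: (hunif _ nb).
apply: filterS => n hn.
have mDB : measurable (D `\` B) by exact: measurableD.
have -> : D = A `|` (D `\` B) by rewrite /A setUIDK.
rewrite ge0_integral_setU//; last 3 first.
- rewrite /A setUIDK; apply: sqr_measurable => //; exact: measurable_funB.
- by move=> x _; rewrite lee_fin sqr_ge0.
- by apply/disj_setPS => x [[_ Bx] [_ nBx]].
have -> : e%:E = (e / 2)%:E + (e / 2)%:E by rewrite -EFinD -splitr.
apply: leeD.
  apply: (@le_trans _ _ (\int[mu]_(x in A) (2%:E * (h n x ^+ 2)%:E + 2%:E * (g x ^+ 2)%:E))).
    apply: ge0_le_integral => //.
    - by move=> x _; rewrite lee_fin sqr_ge0.
    - by apply: sqr_measurable => //; exact: measurable_funB.
    - by apply: emeasurable_funD; apply: measurable_funeM; exact: sqr_measurable.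
    move=> x _; rewrite -!EFinM -EFinD lee_fin.
    have := sqr_ge0 (h n x + g x)%R; rewrite !expr2; lra.
  rewrite ge0_integralD//; last 4 first.
  - by move=> x _; rewrite -EFinM lee_fin mulr_ge0// sqr_ge0.
  - by apply: measurable_funeM; exact: sqr_measurable.
  - by move=> x _; rewrite -EFinM lee_fin mulr_ge0// sqr_ge0.
  - by apply: measurable_funeM; exact: sqr_measurable.
  rewrite !ge0_integralZl//; last 4 first.
  - exact: sqr_measurable.
  - by move=> x _; rewrite lee_fin sqr_ge0.
  - exact: sqr_measurable.
  - by move=> x _; rewrite lee_fin sqr_ge0.
  have -> : (e / 2)%:E = 2%:E * (e / 8)%:E + 2%:E * (e / 8)%:E.
    by rewrite -!EFinM -EFinD; congr EFin; field.
  by apply: leeD; rewrite lee_pmul2l//; exact: hA.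
apply: (@le_trans _ _ (\int[mu]_(x in D `\` B) (eps%:E))).
  apply: ge0_le_integral => //.
  - by move=> x _; rewrite lee_fin sqr_ge0.
  - by apply: sqr_measurable => //; exact: measurable_funB.
  - move=> x /hn hx; rewrite lee_fin -real_normK ?num_real// distrC.
    have : (eps <= 1)%R by rewrite ge_min lexx.
    have := normr_ge0 (g x - h n x)%R.
    by rewrite expr2; nra.
rewrite integral_cst//; apply: (@le_trans _ _ (eps%:E * mu D)).
  rewrite lee_pmul2l//; apply: le_measure; rewrite ?inE//; exact: subDsetl.
have mufin : mu D \is a fin_num by rewrite ge0_fin_numE.
rewrite -(fineK mufin) -EFinM lee_fin.
apply: (@le_trans _ _ (e / (2 * m) * m)%R).
  apply: ler_pM; [exact: ltW|exact: fine_ge0| |].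
    by rewrite ge_min lexx orbT.
  by rewrite lerDl.
by rewrite le_eqVlt; apply/orP; left; apply/eqP; field; rewrite gt_eqF// (lt_le_trans _ m1).
Qed.

End vitali.

(** * Time integrals with values in L^2 *)

Section time_integral.
Context {d d2 : measure_display} {X : measurableType d}
  {S : measurableType d2} {R : realType}.
Variables (mu : {sigma_finite_measure set X -> \bar R})
  (nu : {sigma_finite_measure set S -> \bar R}).
Variables (A : set X) (I : set S) (mA : measurable A) (mI : measurable I).
Variables (q : X * S -> R) (b : S -> R).
Hypothesis mq : measurable_fun (A `*` I) q.
Hypothesis b_ge0 : forall r, (0 <= b r)%R.
Hypothesis intb : nu.-integrable I (EFin \o b).
Hypothesis qb : {ae nu, forall r, I r ->
  sq_integrable mu A (fun x => q (x, r)) /\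
  (norm2 mu A (fun x => q (x, r)) <= b r)%R}.

Let B : R := (\int[nu]_(r in I) b r)%R.

Let mqx x : A x -> measurable_fun I (fun r => q (x, r)).
Proof. by move=> Ax; exact: (measurable_fun_pair1_rect A I mA mI). Qed.

Let mqr r : I r -> measurable_fun A (fun x => q (x, r)).
Proof. by move=> Ir; exact: (measurable_fun_pair2_rect A I mA mI). Qed.

Let mfst d' (U : measurableType d') (k : X -> U) :
  measurable_fun A k -> measurable_fun (A `*` I) (fun p => k p.1).
Proof.
move=> mk; rewrite [Z in measurable_fun _ Z](_ : _ = k \o fst)//.
apply: (measurable_comp mA _ mk); first by move=> _ [[x r] [Ax Ir] <-].
by apply: measurable_funTS; exact: measurable_fst.
Qed.

Let H x := \int[nu]_(r in I) `|q (x, r)|%:E.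

Let H_ge0 x : 0 <= H x. Proof. by apply: integral_ge0 => r _; rewrite lee_fin. Qed.

Let mabsq : measurable_fun (A `*` I) (fun p => `|q p|%:E).
Proof. by apply/measurable_EFinP; apply: measurableT_comp. Qed.

Let mH : measurable_fun A H.
Proof.
apply: (measurable_tonelli_rect1 nu A I mA mI (fun p => `|q p|%:E)) => //.
Qed.

Let H_inner r : I r -> sq_integrable mu A (fun x => q (x, r)) /\
    (norm2 mu A (fun x => q (x, r)) <= b r)%R ->
  \int[mu]_(x in A) (H x * `|q (x, r)|%:E) <= (b r * B)%:E.
Proof.
move=> Ir [qr br].
have mG : measurable_fun (A `*` I) (fun p => (`|q p| * `|q (p.1, r)|)%:E).
  apply/measurable_EFinP; apply: measurable_funM; first exact: measurableT_comp.
  by apply: measurableT_comp => //; exact: (mfst _ _ (fun x => q (x, r)) (mqr _ Ir)).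
have G0 p : (A `*` I) p -> 0 <= (`|q p| * `|q (p.1, r)|)%:E by move=> _; rewrite lee_fin mulr_ge0.
rewrite (eq_integral (fun x => \int[nu]_(s in I) (`|q (x, s)| * `|q (x, r)|)%:E)); last first.
  move=> x; rewrite inE => Ax; rewrite muleC -ge0_integralZl//.
  - by apply: eq_integral => s _; rewrite mulrC EFinM.
  - apply/measurable_EFinP; apply: measurableT_comp => //; exact: mqx.
rewrite -(tonelli_rect1 mu nu A I mA mI _ mG G0) (tonelli_rect2 mu nu A I mA mI _ mG G0).
apply: (@le_trans _ _ (\int[nu]_(s in I) (b r * b s)%:E)).
  apply: ae_ge0_le_integral => //.
  - by move=> s Is; apply: integral_ge0 => x Ax; rewrite lee_fin mulr_ge0.
  - exact: (measurable_tonelli_rect2 mu A I mA mI _ mG G0).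
  - by move=> s Is; rewrite lee_fin mulr_ge0.
  - apply/measurable_EFinP; apply: measurable_funM => //.
    by apply/measurable_EFinP; exact: measurable_int intb.
  apply: filterS qb => s /[swap] Is /(_ Is)[qs bs] /=.
  under eq_integral do rewrite -normrM.
  apply: le_trans (integral_normM_le _ _ mA _ _ qs qr) _.
  by rewrite lee_fin mulrC ler_pM ?norm2_ge0.
under eq_integral do rewrite EFinM.
by rewrite integralZl// (integrable_EFinK nu I mI b intb).
Qed.

(** Minkowski's integral inequality: H^2 is expanded into a double time integral, and Cauchy-Schwarz
    in x bounds its integrand by b(r) b(s). The usual proof divides by the norm of H, which is not
    yet known to be finite here. *)
Let minkowski_H : \int[mu]_(x in A) (H x * H x) <= (B ^+ 2)%:E.
Proof.
have mG : measurable_fun (A `*` I) (fun p => H p.1 * `|q p|%:E).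
  by apply: emeasurable_funM => //; exact: mfst.
have G0 p : (A `*` I) p -> 0 <= H p.1 * `|q p|%:E by move=> _; rewrite mule_ge0.
rewrite (eq_integral (fun x => \int[nu]_(s in I) (H x * `|q (x, s)|%:E))); last first.
  move=> x; rewrite inE => Ax; rewrite -ge0_integralZl//.
  by apply/measurable_EFinP; apply: measurableT_comp => //; exact: mqx.
rewrite -(tonelli_rect1 mu nu A I mA mI _ mG G0) (tonelli_rect2 mu nu A I mA mI _ mG G0)/=.
apply: (@le_trans _ _ (\int[nu]_(r in I) (b r * B)%:E)).
  have B0 : (0 <= B)%R by apply: Rintegral_ge0.
  apply: ae_ge0_le_integral => //.
  - by move=> s Is; apply: integral_ge0 => x Ax; rewrite mule_ge0.
  - exact: (measurable_tonelli_rect2 mu A I mA mI _ mG G0).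
  - by move=> s Is; rewrite lee_fin mulr_ge0.
  - apply/measurable_EFinP; apply: measurable_funM => //.
    by apply/measurable_EFinP; exact: measurable_int intb.
  by apply: filterS qb => s /[swap] Is /(_ Is); exact: H_inner.
under eq_integral do rewrite EFinM.
by rewrite integralZr// (integrable_EFinK nu I mI b intb).
Qed.

Variable h : X -> R.
Hypothesis mh : measurable_fun A h.
Hypothesis hq : {ae mu, forall x, A x ->
  nu.-integrable I (fun r => (q (x, r))%:E) /\
  h x = (\int[nu]_(r in I) q (x, r))%R}.

Let int_sqr_h : \int[mu]_(x in A) (h x ^+ 2)%:E <= (B ^+ 2)%:E.
Proof.
apply: le_trans minkowski_H; apply: ae_ge0_le_integral => //.
- by move=> x _; rewrite lee_fin sqr_ge0.
- by apply/measurable_EFinP; exact: measurable_funX.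
- by move=> x _; rewrite mule_ge0.
- exact: emeasurable_funM.
apply: filterS hq => x /[swap] Ax /(_ Ax)[iq ->].
rewrite -real_normK ?num_real// expr2 EFinM.
have le : `|\int[nu]_(r in I) q (x, r)|%R%:E <= H x.
  rewrite EFin_normr_Rintegral//; apply: le_abse_integral => //.
  exact: measurable_int iq.
by apply: lee_pmul.
Qed.

Lemma sq_integrable_time_integral : sq_integrable mu A h.
Proof.
split => //; apply/integrableP; split.
  by apply/measurable_EFinP; exact: measurable_funX.
under eq_integral do rewrite gee0_abs ?lee_fin ?sqr_ge0//.
by apply: le_lt_trans int_sqr_h _; exact: ltry.
Qed.

Lemma norm2_time_integral : (norm2 mu A h <= \int[nu]_(r in I) b r)%R.
Proof.
have B0 : (0 <= B)%R by apply: Rintegral_ge0.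
rewrite -(@ler_pXn2r _ 2)// ?nnegrE ?norm2_ge0// -lee_fin.
by rewrite -integral_sqrE//; exact: sq_integrable_time_integral.
Qed.

(* Fubini moves the pairing with a fixed [k] inside the time integral. *)
Lemma inner_time_integral_le (k : X -> R) (beta : S -> R) :
  sq_integrable mu A k -> nu.-integrable I (EFin \o beta) ->
  {ae nu, forall r, I r -> (inner mu A k (fun x => q (x, r)) <= beta r)%R} ->
  (inner mu A k h <= \int[nu]_(r in I) beta r)%R.
Proof.
move=> kL2 ibeta kbeta.
have mF : measurable_fun (A `*` I) (fun p => (k p.1 * q p)%:E).
  apply/measurable_EFinP; apply: measurable_funM => //.
  by apply: mfst; case: kL2.
(* Fubini needs joint integrability: at fixed r, Cauchy-Schwarz bounds the x-integral by ||k|| b(r),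
   which is integrable in r. *)
have iF : (mu \x nu).-integrable (A `*` I) (fun p => (k p.1 * q p)%:E).
  apply: integrable_rect21 => //.
  apply: (@le_lt_trans _ _ (\int[nu]_(r in I) (norm2 mu A k * b r)%:E)).
    apply: ae_ge0_le_integral => //.
    - by move=> s Is; apply: integral_ge0.
    - apply: (measurable_tonelli_rect2 mu A I mA mI (fun p => `|(k p.1 * q p)%:E|)) => //.
      exact: measurableT_comp.
    - by move=> s Is; rewrite lee_fin mulr_ge0// norm2_ge0.
    - apply/measurable_EFinP; apply: measurable_funM => //.
      by apply/measurable_EFinP; exact: measurable_int intb.
    apply: filterS qb => s /[swap] Is /(_ Is)[qs bs] /=.
    apply: le_trans (integral_normM_le _ _ mA _ _ kL2 qs) _.
    by rewrite lee_fin ler_pM ?norm2_ge0.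
  under eq_integral do rewrite EFinM.
  rewrite integralZl// (integrable_EFinK nu I mI b intb) -EFinM; exact: ltry.
rewrite -lee_fin -(integrable_EFinK nu I mI beta ibeta).
rewrite -(integrable_EFinK mu A mA); last first.
  exact: sq_integrableM sq_integrable_time_integral.
have -> : \int[mu]_(x in A) (k x * h x)%:E =
    \int[mu]_(x in A) \int[nu]_(r in I) (k x * q (x, r))%:E.
  apply: ae_eq_integral => //.
  - by apply/measurable_EFinP; apply: measurable_funM => //; case: kL2.
  - exact: measurable_int (integrable_fubini_rect1 mu nu A I mA mI _ iF).
  apply: filterS hq => x /[swap] Ax /(_ Ax)[iq ->].
  under eq_integral do rewrite EFinM.
  by rewrite integralZl// (integrable_EFinK nu I mI (fun r => q (x, r))) ?EFinM.
rewrite -(fubini_rect1 mu nu A I mA mI _ iF) (fubini_rect2 mu nu A I mA mI _ iF)/=.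
apply: ae_le_integral => //.
  exact: (integrable_fubini_rect2 mu nu A I mA mI _ iF).
apply: filterS2 qb kbeta => r /[swap] kr /[swap] Ir /(_ Ir)[qr _].
rewrite /= (integrable_EFinK mu A mA (fun x => k x * q (x, r))%R).
  by rewrite lee_fin; exact: kr.
exact: sq_integrableM.
Qed.

End time_integral.

(** * Nonlocal operators *)

(** These two properties characterise the subgradients of the absolute value at s and are all that
    monotonicity uses. *)
Lemma dabs_mul_self (R : realType) (s w : R) : dabs s w ->
  (w * s = `|s|)%R /\ (`|w| <= 1)%R.
Proof.
rewrite /dabs; case: ltrP => [s0 ->|s0]; first by rewrite mul1r gtr0_norm// normr1.
case: ltrP => [s1 ->|s1]; first by rewrite mulN1r ltr0_norm// normrN1.
have -> : s = 0%R by apply/eqP; rewrite eq_le s0.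
by rewrite /= in_itv/= => h; rewrite mulr0 normr0 ler_norml.
Qed.

(** Upon expansion the terms w s and v t give |s| + |t|, and the cross terms w t and v s take away
    at most as much. *)
Lemma dabs_monotone (R : realType) (s t w v : R) : dabs s w -> dabs t v ->
  (0 <= (w - v) * (s - t))%R.
Proof.
move=> /dabs_mul_self[ws w1] /dabs_mul_self[vt v1].
have wt : (w * t <= `|t|)%R.
  by apply: le_trans (ler_norm _) _; rewrite normrM ler_piMl.
have vs : (v * s <= `|s|)%R.
  by apply: le_trans (ler_norm _) _; rewrite normrM ler_piMl.
by nra.
Qed.

Section kernels.
Context {d : measure_display} {X : measurableType d} {R : realType}.
Variables (mu : {sigma_finite_measure set X -> \bar R}).
Variables (A : set X) (mA : measurable A) (muA : mu A = 1).

Local Notation AA := (A `*` A).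
Local Notation mu2 := (mu \x mu).

Let mAA : measurable AA. Proof. exact: measurableX. Qed.

Let mu2AA : mu2 AA < +oo.
Proof. rewrite product_measure1E// [X in X * _]muA mul1e [X in X < _]muA; exact: ltry. Qed.

Let integral_unit (r : R) : \int[mu]_(x in A) r%:E = r%:E.
Proof.
have := integral_cst mu mA r%:E; rewrite /= => ->.
by rewrite [X in _ * X]muA mule1.
Qed.

(** The norm is preserved because [A] has measure 1. This lets a pairing on [A] against a kernel
    integral be estimated as a pairing on the square. *)
Lemma sq_integrable_fst (z : X -> R) : sq_integrable mu A z ->
  sq_integrable mu2 AA (fun p => z p.1) /\
  norm2 mu2 AA (fun p => z p.1) = norm2 mu A z.
Proof.
move=> zL2.
have mz : measurable_fun AA (fun p => z p.1).
  rewrite [Z in measurable_fun _ Z](_ : _ = z \o fst)//.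
  have [mz _] := zL2.
  apply: (measurable_comp mA _ mz); first by move=> _ [[x y] [Ax Ay] <-].
  by apply: measurable_funTS; exact: measurable_fst.
have e : \int[mu2]_(p in AA) (z p.1 ^+ 2)%:E = (norm2 mu A z ^+ 2)%:E.
  rewrite (tonelli_rect1 mu mu A A mA mA (fun p => (z p.1 ^+ 2)%:E)).
  - rewrite -integral_sqrE//; apply: eq_integral => x _ /=.
    exact: integral_unit.
  - by apply/measurable_EFinP; exact: measurable_funX.
  - by move=> p _; rewrite lee_fin sqr_ge0.
have zL2' : sq_integrable mu2 AA (fun p => z p.1).
  split => //; apply/integrableP; split.
    by apply/measurable_EFinP; exact: measurable_funX.
  under eq_integral do rewrite gee0_abs ?lee_fin ?sqr_ge0//.
  by rewrite e ltry.
split => //; move: e; rewrite integral_sqrE// => -[] /eqP.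
by rewrite eqrXn2 ?norm2_ge0// => /eqP.
Qed.

Section kernel.
Variables (K : X -> X -> R) (C : R).
Hypothesis mK : measurable_fun AA (fun p => K p.1 p.2).
Hypothesis K_ge0 : forall x y, A x -> A y -> (0 <= K x y)%R.
Hypothesis K_bnd : forall x, A x -> \int[mu]_(y in A) (K x y ^+ 2)%:E <= C%:E.

Lemma sq_integrable_kernel : sq_integrable mu2 AA (fun p => K p.1 p.2).
Proof.
have mK2 : measurable_fun AA (fun p => (K p.1 p.2 ^+ 2)%:E).
  by apply/measurable_EFinP; exact: measurable_funX.
have K20 p : AA p -> 0 <= (K p.1 p.2 ^+ 2)%:E by move=> _; rewrite lee_fin sqr_ge0.
split => //; apply/integrableP; split => //.
under eq_integral do rewrite gee0_abs ?lee_fin ?sqr_ge0//.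
rewrite (tonelli_rect1 mu mu A A mA mA _ mK2 K20)/=.
apply: (@le_lt_trans _ _ (\int[mu]_(x in A) (cst `|C|%:E) x)).
  apply: ge0_le_integral => //.
  - by move=> x Ax; apply: integral_ge0 => y Ay; rewrite lee_fin sqr_ge0.
  - exact: (measurable_tonelli_rect1 mu A A mA mA _ mK2 K20).
  - by move=> x /K_bnd /le_trans; apply; rewrite lee_fin ler_norm.
by rewrite integral_unit ltry.
Qed.

Variable w : X -> X -> R.
Hypothesis mw : measurable_fun AA (fun p => w p.1 p.2).
Hypothesis w1 : {ae mu2, forall p, AA p -> (`|w p.1 p.2| <= 1)%R}.

Lemma sq_integrable_kernelM :
  sq_integrable mu2 AA (fun p => (K p.1 p.2 * w p.1 p.2)%R).
Proof.
apply: (ae_le_sq_integrable _ _ mAA _ (fun p => K p.1 p.2)).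
- exact: measurable_funM.
- exact: sq_integrable_kernel.
apply: filterS w1 => p wp /wp wp1; rewrite normrM.
by rewrite ler_piMr.
Qed.

Lemma sq_integrable_integrable d' (Y : measurableType d')
    (m : {measure set Y -> \bar R}) (D : set Y) (f : Y -> R) : measurable D ->
  m D < +oo -> sq_integrable m D f -> m.-integrable D (EFin \o f).
Proof.
move=> mD mDoo fL2.
have := sq_integrableM m D mD _ _ fL2 (sq_integrable_cst m D mD 1%R mDoo).
by under eq_fun do rewrite /= mulr1.
Qed.

Lemma integrable_kernelM :
  mu2.-integrable AA (EFin \o (fun p => (K p.1 p.2 * w p.1 p.2)%R)).
Proof. exact: sq_integrable_integrable sq_integrable_kernelM. Qed.

Lemma measurable_kernel_integral :
  measurable_fun A (fun x => \int[mu]_(y in A) (K x y * w x y))%R.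
Proof.
rewrite [Z in measurable_fun _ Z](_ : _ =
  fine \o (fun x => \int[mu]_(y in A) (K x y * w x y)%:E))//.
apply: measurableT_comp => //.
exact: measurable_int (integrable_fubini_rect1 mu mu A A mA mA _ integrable_kernelM).
Qed.

(** The supremum over x in the mixed norm of K is what makes this bound uniform in x. *)
Lemma kernel_integral_bound : {ae mu, forall x, A x ->
  (`|\int[mu]_(y in A) (K x y * w x y)| <= 1 + C)%R}.
Proof.
have := ae_integrable_rect1 mu mu A A mA mA _ integrable_kernelM.
have := ae_rect1 mu mu A A (fun p => (`|w p.1 p.2| <= 1)%R) w1.
apply: filterS2 => x wx ix Ax; have {}wx := wx Ax; have {}ix := ix Ax.
have mKx : measurable_fun A (K x).
  exact: (measurable_fun_pair1_rect A A mA mA _ _ (fun p => K p.1 p.2)).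
have Kx2 : mu.-integrable A (fun y => (K x y ^+ 2)%:E).
  apply/integrableP; split; first by apply/measurable_EFinP; exact: measurable_funX.
  under eq_integral do rewrite gee0_abs ?lee_fin ?sqr_ge0//.
  by apply: le_lt_trans (K_bnd _ Ax) _; exact: ltry.
rewrite -lee_fin EFin_normr_Rintegral//.
apply: le_trans (le_abse_integral _ mA (measurable_int _ ix)) _.
apply: (@le_trans _ _ (\int[mu]_(y in A) (1 + (K x y ^+ 2)%:E))).
  apply: ae_ge0_le_integral => //.
  - by apply: measurableT_comp => //; exact: measurable_int ix.
  - by move=> y _; rewrite adde_ge0// lee_fin sqr_ge0.
  - by apply: emeasurable_funD => //; exact: measurable_int Kx2.
  apply: filterS wx => y wy Ay; rewrite -EFinD lee_fin normrM.
  have := wy Ay; have := K_ge0 _ _ Ax Ay => K0; rewrite (ger0_norm K0) => wy1.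
  apply: (@le_trans _ _ (K x y)); first by rewrite ler_piMr.
  by have := sqr_ge0 (K x y - 1)%R; rewrite !expr2; nra.
rewrite ge0_integralD//; last 2 first.
- by move=> y _; rewrite lee_fin sqr_ge0.
- exact: measurable_int Kx2.
rewrite EFinD; apply: leeD; last exact: K_bnd.
by rewrite integral_unit.
Qed.

End kernel.

Section monotone.
Variables (K : X -> X -> R) (C : R).
Hypothesis mK : measurable_fun AA (fun p => K p.1 p.2).
Hypothesis K_ge0 : forall x y, A x -> A y -> (0 <= K x y)%R.
Hypothesis K_sym : forall x y, A x -> A y -> K x y = K y x.
Hypothesis K_bnd : forall x, A x -> \int[mu]_(y in A) (K x y ^+ 2)%:E <= C%:E.
Variables (u v : X -> R) (w w' : X -> X -> R).
Hypothesis mw : measurable_fun AA (fun p => w p.1 p.2).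
Hypothesis mw' : measurable_fun AA (fun p => w' p.1 p.2).
Hypothesis w1 : {ae mu2, forall p, AA p -> (`|w p.1 p.2| <= 1)%R}.
Hypothesis w'1 : {ae mu2, forall p, AA p -> (`|w' p.1 p.2| <= 1)%R}.
Hypothesis wN : {ae mu2, forall p, AA p -> w p.1 p.2 = (- w p.2 p.1)%R}.
Hypothesis w'N : {ae mu2, forall p, AA p -> w' p.1 p.2 = (- w' p.2 p.1)%R}.
Hypothesis wu : {ae mu2, forall p, AA p -> dabs (u p.2 - u p.1)%R (w p.1 p.2)}.
Hypothesis w'v : {ae mu2, forall p, AA p -> dabs (v p.2 - v p.1)%R (w' p.1 p.2)}.
Hypothesis zL2 : sq_integrable mu A (fun x => u x - v x)%R.

(* Exchanging x and y symmetrises the integrand into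
   K (w - w') ((u - v)(x) - (u - v)(y)) / 2, which is nonpositive. *)
Lemma kernel_monotone :
  (inner mu2 AA (fun p => u p.1 - v p.1)
     (fun p => K p.1 p.2 * (w p.1 p.2 - w' p.1 p.2)) <= 0)%R.
Proof.
set z := (fun x => u x - v x)%R.
pose F p := (z p.1 * (K p.1 p.2 * (w p.1 p.2 - w' p.1 p.2)))%R.
have KwL2 : sq_integrable mu2 AA (fun p => K p.1 p.2 * (w p.1 p.2 - w' p.1 p.2))%R.
  have := sq_integrableB _ _ mAA _ _
    (sq_integrable_kernelM K C mK K_bnd w mw w1)
    (sq_integrable_kernelM K C mK K_bnd w' mw' w'1).
  by under eq_fun do rewrite -mulrBr.
have [z1L2 _] := sq_integrable_fst z zL2.
have iF : mu2.-integrable AA (EFin \o F) by exact: sq_integrableM.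
have iFs := integrable_swap mu A mA _ iF.
suff : (2 * \int[mu2]_(p in AA) F p <= 0)%R by rewrite pmulr_rle0.
rewrite mulr2n mulrDl mul1r.
have {2}-> : (\int[mu2]_(p in AA) F p = \int[mu2]_(p in AA) F (p.2, p.1))%R.
  by rewrite /Rintegral -(integral_swap mu A mA _ iF).
rewrite -RintegralD//.
have -> : (0 = \int[mu2]_(p in AA) (cst 0 p))%R.
  by rewrite Rintegral_cst// mul0r.
apply: ae_le_Rintegral => //.
- exact: (integrableD mAA iF iFs).
- exact: (integrable0 mu2 AA).
apply: filterS2 (filterI wu w'v) (filterI wN w'N) => -[x y]/= [wup wvp] [wp w'p] [/= Ax Ay].
have {}wup := wup (conj Ax Ay); have {}wvp := wvp (conj Ax Ay).
have {}wp := wp (conj Ax Ay); have {}w'p := w'p (conj Ax Ay).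
have := dabs_monotone _ _ _ _ _ wup wvp; have := K_ge0 _ _ Ax Ay.
rewrite /F/= (K_sym _ _ Ay Ax).
have -> : w y x = (- w x y)%R by rewrite wp opprK.
have -> : w' y x = (- w' x y)%R by rewrite w'p opprK.
rewrite /z => K0 m0.
have := mulr_ge0 K0 m0.
set k := K x y; set a := w x y; set b := w' x y.
(* The subdifferential is taken at u(y) - u(x) whereas the symmetrised integrand carries z(x) -
   z(y), so that integrand is exactly the opposite of the nonnegative quantity in [h]. *)
move=> h; rewrite -subr_ge0; apply: le_trans h _.
by rewrite le_eqVlt; apply/orP; left; apply/eqP; ring.
Qed.

End monotone.

Section two_kernels.
Variables (K1 K2 : X -> X -> R) (C1 C2 : R).
Hypothesis mK1 : measurable_fun AA (fun p => K1 p.1 p.2).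
Hypothesis mK2 : measurable_fun AA (fun p => K2 p.1 p.2).
Hypothesis K2_ge0 : forall x y, A x -> A y -> (0 <= K2 x y)%R.
Hypothesis K2_sym : forall x y, A x -> A y -> K2 x y = K2 y x.
Hypothesis K1_bnd : forall x, A x -> \int[mu]_(y in A) (K1 x y ^+ 2)%:E <= C1%:E.
Hypothesis K2_bnd : forall x, A x -> \int[mu]_(y in A) (K2 x y ^+ 2)%:E <= C2%:E.
Variables (u v : X -> R) (w w' : X -> X -> R).
Hypothesis mw : measurable_fun AA (fun p => w p.1 p.2).
Hypothesis mw' : measurable_fun AA (fun p => w' p.1 p.2).
Hypothesis w1 : {ae mu2, forall p, AA p -> (`|w p.1 p.2| <= 1)%R}.
Hypothesis w'1 : {ae mu2, forall p, AA p -> (`|w' p.1 p.2| <= 1)%R}.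
Hypothesis wN : {ae mu2, forall p, AA p -> w p.1 p.2 = (- w p.2 p.1)%R}.
Hypothesis w'N : {ae mu2, forall p, AA p -> w' p.1 p.2 = (- w' p.2 p.1)%R}.
Hypothesis wu : {ae mu2, forall p, AA p -> dabs (u p.2 - u p.1)%R (w p.1 p.2)}.
Hypothesis w'v : {ae mu2, forall p, AA p -> dabs (v p.2 - v p.1)%R (w' p.1 p.2)}.
Hypothesis zL2 : sq_integrable mu A (fun x => u x - v x)%R.

(** Split K1 w - K2 w' as (K1 - K2) w + K2 (w - w'). The first part is handled by Cauchy-Schwarz and
    |w| <= 1; the second is nonpositive by monotonicity, through the sign and symmetry of K2. *)
Lemma inner_kernel_le :
  (inner mu A (fun x => u x - v x)
     (fun x => \int[mu]_(y in A) (K1 x y * w x y) -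
               \int[mu]_(y in A) (K2 x y * w' x y)) <=
   norm2 mu A (fun x => u x - v x) *
   norm2 mu2 AA (fun p => K1 p.1 p.2 - K2 p.1 p.2))%R.
Proof.
set z := (fun x => u x - v x)%R.
have [z1L2 z1n] := sq_integrable_fst z zL2.
have Kw1 := sq_integrable_kernelM K1 C1 mK1 K1_bnd w mw w1.
have Kw2 := sq_integrable_kernelM K2 C2 mK2 K2_bnd w' mw' w'1.
have Kw21 := sq_integrable_kernelM K2 C2 mK2 K2_bnd w mw w1.
have KB := sq_integrableB _ _ mAA _ _ (sq_integrable_kernel _ _ mK1 K1_bnd)
  (sq_integrable_kernel _ _ mK2 K2_bnd).
have Kw := sq_integrableB _ _ mAA _ _ Kw1 Kw2.
have iG := sq_integrableM _ _ mAA _ _ z1L2 Kw.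
have -> : (inner mu A z (fun x => \int[mu]_(y in A) (K1 x y * w x y) -
               \int[mu]_(y in A) (K2 x y * w' x y)) =
  inner mu2 AA (fun p => z p.1)
    (fun p => K1 p.1 p.2 * w p.1 p.2 - K2 p.1 p.2 * w' p.1 p.2))%R.
  rewrite /inner /Rintegral (fubini_rect1 mu mu A A mA mA _ iG); congr fine.
  apply: ae_eq_integral => //.
  - apply/measurable_EFinP; apply: measurable_funM; first by case: zL2.
    apply: measurable_funB.
      exact: (measurable_kernel_integral K1 C1).
    exact: (measurable_kernel_integral K2 C2).
  - exact: measurable_int (integrable_fubini_rect1 mu mu A A mA mA _ iG).
  have i1 := integrable_kernelM K1 C1 mK1 K1_bnd w mw w1.
  have i2 := integrable_kernelM K2 C2 mK2 K2_bnd w' mw' w'1.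
  apply: filterS2 (ae_integrable_rect1 mu mu A A mA mA _ i1)
    (ae_integrable_rect1 mu mu A A mA mA _ i2) => x /[swap] + /[swap] Ax.
  move=> /(_ Ax) i2x /(_ Ax) i1x /=.
  under [RHS]eq_integral do rewrite EFinM EFinB.
  rewrite integralZl//; last exact: (integrableB mA i1x i2x).
  rewrite integralB_EFin//.
  rewrite (integrable_EFinK mu A mA (fun y => K1 x y * w x y)%R i1x).
  by rewrite (integrable_EFinK mu A mA (fun y => K2 x y * w' x y)%R i2x).
have Kw1L2 : sq_integrable mu2 AA (fun p => (K1 p.1 p.2 - K2 p.1 p.2) * w p.1 p.2)%R.
  by have := sq_integrableB _ _ mAA _ _ Kw1 Kw21; under eq_fun do rewrite -mulrBl.
have Kw2L2 : sq_integrable mu2 AA (fun p => K2 p.1 p.2 * (w p.1 p.2 - w' p.1 p.2))%R.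
  by have := sq_integrableB _ _ mAA _ _ Kw21 Kw2; under eq_fun do rewrite -mulrBr.
have -> : (fun p => K1 p.1 p.2 * w p.1 p.2 - K2 p.1 p.2 * w' p.1 p.2)%R =
  (fun p => (K1 p.1 p.2 - K2 p.1 p.2) * w p.1 p.2 +
    K2 p.1 p.2 * (w p.1 p.2 - w' p.1 p.2))%R.
  by apply/funext => p; ring.
rewrite innerDr// -[leRHS]addr0; apply: lerD; last first.
  exact: (kernel_monotone K2 C2).
apply: le_trans (cauchy_schwarz_inner _ _ mAA _ _ z1L2 Kw1L2) _.
rewrite z1n ler_wpM2l ?norm2_ge0//; apply: ae_le_norm2 => //.
  by case: Kw1L2.
by apply: filterS w1 => p wp /wp wp1; rewrite normrM ler_piMr.
Qed.

End two_kernels.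

End kernels.

(** * Energy estimate *)

#[local] Instance lebesgue_ae_filter (R : realType) :
  Filter (almost_everywhere (@lebesgue_measure R)) :=
  ae_filter_ringOfSetsType (@lebesgue_measure R).

Section increments.
Local Open Scope ring_scope.
Local Open Scope classical_set_scope.
Context {R : realType}.
Local Notation leb := (@lebesgue_measure R).
Variables (T : R) (b : R -> R).
Hypothesis intb : leb.-integrable `[0, T] (EFin \o b).

Lemma integrable_sub_itv s t : 0 <= s -> t <= T ->
  leb.-integrable `[s, t] (EFin \o b).
Proof.
move=> s0 tT; apply: integrableS intb => //.
by apply: subset_itv; rewrite bnd_simp.
Qed.

Lemma Rintegral_increment s t : 0 <= s -> s <= t -> t <= T ->
  \int[leb]_(r in `[0, t]) b r - \int[leb]_(r in `[0, s]) b r =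
  \int[leb]_(r in `[s, t]) b r.
Proof.
move=> s0 st tT; rewrite Rintegral_itvB ?bnd_simp//; last exact: integrable_sub_itv.
rewrite Rintegral_itv_obnd_cbnd//.
apply: integrableS (integrable_sub_itv s t s0 tT) => //.
by apply: subset_itv; rewrite bnd_simp.
Qed.

End increments.

Section energy.
Local Open Scope ring_scope.
Local Open Scope classical_set_scope.
Context {d : measure_display} {X : measurableType d} {R : realType}.
Variables (mu : {sigma_finite_measure set X -> \bar R}).
Variables (A : set X) (mA : measurable A).
Local Notation leb := (@lebesgue_measure R).
Variables (T : R) (z : X -> R -> R) (q : X * R -> R) (psi : R -> R) (k c : R).
Hypothesis T0 : 0 < T.
Hypothesis mz : forall t, 0 <= t -> t <= T -> measurable_fun A (z^~ t).
Hypothesis z0L2 : sq_integrable mu A (z^~ 0).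
Hypothesis mq : measurable_fun (A `*` `[0, T]) q.
Hypothesis psi_ge0 : forall r, 0 <= psi r.
Hypothesis ipsi : leb.-integrable `[0, T] (EFin \o psi).
Hypothesis k_ge0 : 0 <= k.
Hypothesis kc : k <= c.
Hypothesis qb : {ae leb, forall r, `[0, T] r ->
  [/\ sq_integrable mu A (fun x => q (x, r)),
      norm2 mu A (fun x => q (x, r)) <= c + psi r &
      sq_integrable mu A (z^~ r) ->
      inner mu A (z^~ r) (fun x => q (x, r)) <=
        norm2 mu A (z^~ r) * (k + psi r)]}.
Hypothesis zq : forall s t, 0 <= s -> s <= t -> t <= T ->
  {ae mu, forall x, A x ->
    leb.-integrable `[s, t] (fun r => (q (x, r))%:E) /\
    z x t - z x s = \int[leb]_(r in `[s, t]) q (x, r)}.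

Let a r := k + psi r.
Let b r := c + psi r.
Let N t := norm2 mu A (z^~ t).

Let c_ge0 : 0 <= c. Proof. exact: le_trans kc. Qed.
Let b_ge0 r : 0 <= b r. Proof. exact: addr_ge0. Qed.
Let a_ge0 r : 0 <= a r. Proof. exact: addr_ge0. Qed.

Let mitv s t : measurable (`[s, t] : set (measurableTypeR R)).
Proof. exact: measurable_itv. Qed.

Let icst (e : R) : leb.-integrable `[0, T] (EFin \o cst e).
Proof.
apply: measurable_bounded_integrable => //.
  by rewrite /= lebesgue_measure_itv/= lte_fin T0 -EFinB ltry.
by exists `|e|; split; [exact: num_real|move=> M eM r _ /=; exact: ltW].
Qed.

Let ia : leb.-integrable `[0, T] (EFin \o a).
Proof. exact: (integrableD (mitv _ _) (icst k) ipsi). Qed.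
Let ib : leb.-integrable `[0, T] (EFin \o b).
Proof. exact: (integrableD (mitv _ _) (icst c) ipsi). Qed.

Let FA t := \int[leb]_(r in `[0, t]) a r.
Let FB t := \int[leb]_(r in `[0, t]) b r.

Let FB_inc s t (s0 : 0 <= s) (st : s <= t) (tT : t <= T) :
  FB t - FB s = \int[leb]_(r in `[s, t]) b r := Rintegral_increment T b ib s t s0 st tT.
Let FA_inc s t (s0 : 0 <= s) (st : s <= t) (tT : t <= T) :
  FA t - FA s = \int[leb]_(r in `[s, t]) a r := Rintegral_increment T a ia s t s0 st tT.

Let FB_nd s t : 0 <= s -> s <= t -> t <= T -> FB s <= FB t.
Proof.
move=> s0 st tT; rewrite -subr_ge0 FB_inc//; exact: Rintegral_ge0.
Qed.

Let FA_nd s t : 0 <= s -> s <= t -> t <= T -> FA s <= FA t.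
Proof.
move=> s0 st tT; rewrite -subr_ge0 FA_inc//; exact: Rintegral_ge0.
Qed.

Let FAB s t : 0 <= s -> s <= t -> t <= T -> FA t - FA s <= FB t - FB s.
Proof.
move=> s0 st tT; rewrite FA_inc// FB_inc//; apply: le_Rintegral => //.
- exact: (integrable_sub_itv T a ia).
- exact: (integrable_sub_itv T b ib).
by move=> r _; rewrite lerD2r.
Qed.

Let ae_sub (P : R -> Prop) s t : 0 <= s -> t <= T ->
  {ae leb, forall r, `[0, T] r -> P r} -> {ae leb, forall r, `[s, t] r -> P r}.
Proof.
move=> s0 tT; apply: filterS => r Pr rst; apply: Pr.
by apply: subset_itv rst; rewrite bnd_simp.
Qed.

Let mq_sub s t : 0 <= s -> t <= T -> measurable_fun (A `*` `[s, t]) q.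
Proof.
move=> s0 tT; apply: measurable_funS mq; first exact: measurableX.
by apply: setSX => //; apply: subset_itv; rewrite bnd_simp.
Qed.

Let qb_sub s t : 0 <= s -> t <= T -> {ae leb, forall r, `[s, t] r ->
  sq_integrable mu A (fun x => q (x, r)) /\
  norm2 mu A (fun x => q (x, r)) <= b r}.
Proof.
by move=> s0 tT; apply: ae_sub => //; apply: filterS qb => r h /h[].
Qed.

Let mz_sub s t : 0 <= s -> s <= t -> t <= T ->
  measurable_fun A (fun x => z x t - z x s).
Proof.
move=> s0 st tT; apply: measurable_funB.
  exact: mz (le_trans s0 st) tT.
exact: mz s0 (le_trans st tT).
Qed.

Let incr_L2 s t : 0 <= s -> s <= t -> t <= T ->
  sq_integrable mu A (fun x => z x t - z x s).
Proof.
move=> s0 st tT.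
exact: (sq_integrable_time_integral mu leb A `[s, t] mA (mitv _ _) q b
  (mq_sub _ _ s0 tT) b_ge0 (integrable_sub_itv T b ib s t s0 tT)
  (qb_sub _ _ s0 tT) _ (mz_sub _ _ s0 st tT) (zq _ _ s0 st tT)).
Qed.

Let incr_norm s t : 0 <= s -> s <= t -> t <= T ->
  norm2 mu A (fun x => z x t - z x s) <= FB t - FB s.
Proof.
move=> s0 st tT; rewrite FB_inc//.
exact: (norm2_time_integral mu leb A `[s, t] mA (mitv _ _) q b
  (mq_sub _ _ s0 tT) b_ge0 (integrable_sub_itv T b ib s t s0 tT)
  (qb_sub _ _ s0 tT) _ (mz_sub _ _ s0 st tT) (zq _ _ s0 st tT)).
Qed.

(** Obtained from z(0) in L^2 and the bound on increments alone. The pairing bound in [qb]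
    presupposes this fact, so it is stated there as an implication and becomes usable only from here
    on. *)
Lemma energy_sq_integrable t : 0 <= t -> t <= T -> sq_integrable mu A (z^~ t).
Proof.
move=> t0 tT.
have := sq_integrableD _ _ mA _ _ z0L2 (incr_L2 _ _ (lexx 0) t0 tT).
by under eq_fun do rewrite subrKC.
Qed.

Let growth s t : 0 <= s -> s <= t -> t <= T ->
  N t ^+ 2 <= N t * N s + N t * (FA t - FA s) + 2 * (FB t - FB s) ^+ 2.
Proof.
move=> s0 st tT; have t0 := le_trans s0 st; have sT := le_trans st tT.
have ztL2 := energy_sq_integrable _ t0 tT.
have zsL2 := energy_sq_integrable _ s0 sT.
have Nt0 : 0 <= N t by exact: norm2_ge0.
set dB := FB t - FB s; set dA := FA t - FA s.
have dB0 : 0 <= dB by rewrite subr_ge0 FB_nd.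
have dA0 : 0 <= dA by rewrite subr_ge0 FA_nd.
have dAB : dA <= dB by exact: FAB.
(* Bounds <z(t), q(r)> after writing z(t) = z(r) + (z(t) - z(r)): the first term uses ||z(r)|| <= N
   t + dB, the second Cauchy-Schwarz with ||z(t) - z(r)|| <= dB. *)
pose beta r := (N t + dB) * a r + dB * b r.
have ias := integrable_sub_itv T a ia s t s0 tT.
have ibs := integrable_sub_itv T b ib s t s0 tT.
have ia1 : leb.-integrable `[s, t] (EFin \o (fun r => (N t + dB) * a r)).
  exact: (integrableZl (mitv _ _) (N t + dB) ias).
have ib1 : leb.-integrable `[s, t] (EFin \o (fun r => dB * b r)).
  exact: (integrableZl (mitv _ _) dB ibs).
have ibeta : leb.-integrable `[s, t] (EFin \o beta).
  exact: (integrableD (mitv _ _) ia1 ib1).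
have key : inner mu A (z^~ t) (fun x => z x t - z x s) <=
    \int[leb]_(r in `[s, t]) beta r.
  apply: (inner_time_integral_le mu leb A `[s, t] mA (mitv _ _) q b
    (mq_sub _ _ s0 tT) b_ge0 ibs
    (qb_sub _ _ s0 tT) _ (mz_sub _ _ s0 st tT) (zq _ _ s0 st tT)) => //.
  have := ae_sub _ s t s0 tT qb; apply: filterS => r h rst.
  have [qL2 qn zqr] := h rst.
  move: rst; rewrite /= in_itv/= => /andP[sr rt].
  have r0 := le_trans s0 sr; have rT := le_trans rt tT.
  have zrL2 := energy_sq_integrable _ r0 rT.
  have trL2 := incr_L2 _ _ r0 rt tT.
  have -> : z^~ t = (fun x => z x r + (z x t - z x r)).
    by apply/funext => x; rewrite subrKC.
  rewrite innerDl//.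
  have trn : norm2 mu A (fun x => z x t - z x r) <= dB.
    apply: le_trans (incr_norm _ _ r0 rt tT) _.
    by rewrite lerD2l lerN2 FB_nd.
  apply: lerD.
    apply: le_trans (zqr zrL2) _; apply: ler_wpM2r; first exact: a_ge0.
    have := norm2B _ _ mA _ _ ztL2 trL2.
    have -> : (fun x => z x t - (z x t - z x r)) = z^~ r.
      by apply/funext => x; rewrite subKr.
    by move/le_trans; apply; rewrite lerD2l.
  apply: le_trans (cauchy_schwarz_inner _ _ mA _ _ trL2 qL2) _.
  by rewrite ler_pM ?norm2_ge0.
have intbeta : \int[leb]_(r in `[s, t]) beta r = (N t + dB) * dA + dB * dB.
  by rewrite RintegralD// !RintegralZl// -FA_inc// -FB_inc.
have cs := cauchy_schwarz_inner _ _ mA _ _ ztL2 zsL2.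
have -> : N t ^+ 2 = inner mu A (z^~ t) (z^~ s) +
    inner mu A (z^~ t) (fun x => z x t - z x s).
  rewrite -innerDr//; last exact: incr_L2.
  rewrite norm2_sqr; congr inner; apply/funext => x; by rewrite subrKC.
rewrite intbeta in key; rewrite -/(N t) -/(N s) in cs.
(* Since a <= b, the mixed term is absorbed into the quadratic error, which thereby gets its factor
   2. *)
have : dB * dA <= dB * dB by exact: ler_wpM2l.
by rewrite expr2; lra.
Qed.

Lemma energy_estimate t : 0 <= t -> t <= T ->
  norm2 mu A (z^~ t) <=
  norm2 mu A (z^~ 0) + \int[leb]_(r in `[0, T]) psi r + T * k.
Proof.
move=> t0 tT.
have FBc : {within `[0, T], continuous FB}.
  exact: (parameterized_integral_continuous (ltW T0) ib).
have := quadratic_growth T N FA FB (norm2_ge0 _ _ _) FBc FB_nd FA_nd growth t t0 tT.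
move/le_trans; apply; rewrite -addrA lerD2l.
have FA0 : FA 0 = 0 by rewrite /FA set_itv1 Rintegral_set1.
(* Passing to the final time makes the bound uniform in t, as the supremum norm requires. *)
apply: (@le_trans _ _ (FA T)); first by rewrite FA0 subr0 FA_nd.
have -> : FA T = \int[leb]_(r in `[0, T]) cst k r + \int[leb]_(r in `[0, T]) psi r.
  by rewrite -RintegralD.
have -> : \int[leb]_(r in `[0, T]) cst k r = k * fine (leb `[0, T]).
  exact: Rintegral_cst.
rewrite lebesgue_measure_itv/= lte_fin T0.
by rewrite -EFinB subr0/= [T * k]mulrC [leRHS]addrC.
Qed.

End energy.

(** * Slices and increments in time *)

Section slices.
Context {d : measure_display} {X : measurableType d} {R : realType}.
Variables (mu : {sigma_finite_measure set X -> \bar R}).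
Variables (A : set X) (mA : measurable A).
Local Notation leb := (@lebesgue_measure R).
Variables (T : R) (f : X -> R -> R).
Hypothesis mf : measurable_fun (A `*` `[0%R, T]) (fun p => f p.1 p.2).

Let mI : measurable (`[0%R, T] : set (measurableTypeR R)).
Proof. exact: measurable_itv. Qed.

Let mf2 : measurable_fun (A `*` `[0%R, T]) (fun p => (f p.1 p.2 ^+ 2)%:E).
Proof. by apply/measurable_EFinP; exact: measurable_funX. Qed.

Let mfr r : `[0%R, T] r -> measurable_fun A (f^~ r).
Proof.
exact: (measurable_fun_pair2_rect A `[0%R, T] mA mI _ _ (fun p => f p.1 p.2)).
Qed.

Let mint : measurable_fun (`[0%R, T] : set (measurableTypeR R))
  (fun r => \int[mu]_(x in A) (f x r ^+ 2)%:E).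
Proof.
apply: (measurable_tonelli_rect2 mu A `[0%R, T] mA mI _ mf2).
by move=> p _; rewrite lee_fin sqr_ge0.
Qed.

Lemma measurable_slice_norm2 :
  measurable_fun (`[0%R, T] : set (measurableTypeR R)) (fun r => norm2 mu A (f^~ r)).
Proof.
rewrite [Z in measurable_fun _ Z](_ : _ = (fun y => @powR R y 2^-1%R) \o
  (fine \o (fun r => \int[mu]_(x in A) (f x r ^+ 2)%:E))).
  by apply: measurableT_comp => //; exact: measurableT_comp.
apply/funext => r /=; rewrite powR12_sqrt; last first.
  by apply: fine_ge0; apply: integral_ge0 => x _; rewrite lee_fin sqr_ge0.
by [].
Qed.

Lemma slice_finite r : `[0%R, T] r ->
  (\int[mu]_(x in A) (f x r ^+ 2)%:E) `^ 2^-1 < +oo ->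
  sq_integrable mu A (f^~ r).
Proof.
move=> rT h; split; first exact: mfr.
apply/integrableP; split.
  by apply/measurable_EFinP; apply: measurable_funX; exact: mfr.
under eq_integral do rewrite gee0_abs ?lee_fin ?sqr_ge0//.
rewrite ltey; apply/negP => /eqP e; by move: h; rewrite e poweRyr ?ltxx ?invr_eq0 ?pnatr_eq0.
Qed.

Section finite.
Hypothesis fin : \int[leb]_(t in `[0%R, T])
  (\int[mu]_(x in A) (f x t ^+ 2)%:E) `^ 2^-1 < +oo.

Let iL2 : leb.-integrable `[0%R, T]
  (fun t => (\int[mu]_(x in A) (f x t ^+ 2)%:E) `^ 2^-1).
Proof.
apply/integrableP; split; first exact: (measurableT_comp (measurable_poweR _)).
by under eq_integral do rewrite gee0_abs ?poweR_ge0//.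
Qed.

(** An integrable function of time is finite almost everywhere, so finiteness of the mixed norm
    gives square-integrable slices at almost every time. *)
Lemma ae_slice_sq_integrable :
  {ae leb, forall r, `[0%R, T] r -> sq_integrable mu A (f^~ r)}.
Proof.
have := integrable_ae mI iL2; apply: filterS => r h rT.
by apply: slice_finite => //; rewrite -ge0_fin_numE ?poweR_ge0//; exact: h.
Qed.

Lemma integrable_slice_norm2 :
  leb.-integrable `[0%R, T] (EFin \o (fun r => norm2 mu A (f^~ r))).
Proof.
apply/integrableP; split.
  by apply/measurable_EFinP; exact: measurable_slice_norm2.
apply: le_lt_trans fin; apply: ae_ge0_le_integral => //.
- apply: measurableT_comp => //; apply/measurable_EFinP.
  exact: measurable_slice_norm2.
- by move=> r _; exact: poweR_ge0.
- exact: (measurableT_comp (measurable_poweR _)).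
apply: filterS ae_slice_sq_integrable => r h /h rL2.
by rewrite norm2E//= ger0_norm// norm2_ge0.
Qed.
End finite.

Lemma integral_slice_norm2E :
  {ae leb, forall r, `[0%R, T] r -> sq_integrable mu A (f^~ r)} ->
  \int[leb]_(t in `[0%R, T]) (\int[mu]_(x in A) (f x t ^+ 2)%:E) `^ 2^-1 =
  \int[leb]_(t in `[0%R, T]) (norm2 mu A (f^~ t))%:E.
Proof.
move=> fL2; apply: ae_eq_integral => //.
- exact: (measurableT_comp (measurable_poweR _)).
- by apply/measurable_EFinP; exact: measurable_slice_norm2.
by apply: filterS fL2 => r h /h rL2; rewrite norm2E.
Qed.

End slices.

Section increments_of_solutions.
Context {d : measure_display} {X : measurableType d} {R : realType}.
Variables (mu : {sigma_finite_measure set X -> \bar R}).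
Variables (A : set X) (mA : measurable A).
Local Notation leb := (@lebesgue_measure R).
Variables (T : R) (u v : X -> R -> R).
Hypothesis iv : (mu \x leb).-integrable (A `*` `]0%R, T[) (fun p => (v p.1 p.2)%:E).
Hypothesis inc : forall t, `[0%R, T] t -> {ae mu, forall x, A x ->
  (u x t)%:E = (u x 0%R)%:E + \int[leb]_(s in `[0%R, t]) (v x s)%:E}.

Let mI (i : interval R) : measurable ([set` i] : set (measurableTypeR R)).
Proof. exact: measurable_itv. Qed.

(** The derivative v is controlled only on the open interval. Its extension by zero is integrable on
    every closed subinterval for almost every x, and the endpoints, being null, do not affect the
    time integrals. *)
Lemma solution_increment s t : (0 <= s)%R -> (s <= t)%R -> (t <= T)%R ->
  {ae mu, forall x, A x ->
    leb.-integrable `[s, t] (EFin \o ((v x) \_ `]0%R, T[)) /\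
    (u x t - u x s = \int[leb]_(r in `[s, t]) ((v x) \_ `]0%R, T[) r)%R}.
Proof.
move=> s0 st tT; have t0 := le_trans s0 st; have sT := le_trans st tT.
have := ae_integrable_rect1 mu leb A `]0%R, T[ mA (mI _) _ iv.
have hs : `[0%R, T] s by rewrite /= in_itv/= s0.
have ht : `[0%R, T] t by rewrite /= in_itv/= t0.
apply: filterS3 (inc _ hs) (inc _ ht) => x us ut /= ivx Ax.
have {}us := us Ax; have {}ut := ut Ax; have {}ivx := ivx Ax.
set V := (v x) \_ `]0%R, T[.
have iV : leb.-integrable setT (EFin \o V).
  rewrite -restrict_EFin.
  have /(integrable_mkcond _ (mI _)) h := ivx; exact: h.
have iVI (i : interval R) : leb.-integrable [set` i] (EFin \o V).
  exact: integrableS iV.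
have e r : (r <= T)%R -> \int[leb]_(y in `[0%R, r]) (v x y)%:E =
    (\int[leb]_(y in `[0%R, r]) V y)%R%:E.
  move=> rT; rewrite -(integrable_EFinK leb _ (mI _) V (iVI _)).
  rewrite integral_itv_bndoo; last first.
    apply: measurable_funS (measurable_int _ ivx) => //.
    by apply: subset_itvl; rewrite bnd_simp.
  rewrite [RHS]integral_itv_bndoo; last exact: measurable_int (iVI _).
  apply: eq_integral => y; rewrite inE/= in_itv/= => /andP[y0 yr].
  by rewrite /V patchE mem_set//= in_itv/= y0 (lt_le_trans yr).
split; first exact: iVI.
rewrite e// in us; rewrite e// in ut.
move: us ut => [->] [->].
have iV0 : leb.-integrable `[0%R, T] (EFin \o V) by exact: iVI.
by rewrite -(Rintegral_increment T V iV0 s t s0 st tT) opprD addrACA subrr add0r.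
Qed.

End increments_of_solutions.

(** * Bounds for the time derivative at a fixed time *)

Section slice_estimate.
Local Open Scope ring_scope.
Local Open Scope classical_set_scope.
Context {d : measure_display} {X : measurableType d} {R : realType}.
Variables (mu : {sigma_finite_measure set X -> \bar R}).
Variables (A : set X) (mA : measurable A) (muA : (mu A = 1)%E).
Local Notation AA := (A `*` A).
Local Notation mu2 := (mu \x mu)%E.
Variables (K1 K2 : X -> X -> R) (C1 C2 : R).
Hypothesis mK1 : measurable_fun AA (fun p => K1 p.1 p.2).
Hypothesis mK2 : measurable_fun AA (fun p => K2 p.1 p.2).
Hypothesis K1_ge0 : forall x y, A x -> A y -> 0 <= K1 x y.
Hypothesis K2_ge0 : forall x y, A x -> A y -> 0 <= K2 x y.
Hypothesis K2_sym : forall x y, A x -> A y -> K2 x y = K2 y x.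
Hypothesis K1_bnd : forall x, A x -> (\int[mu]_(y in A) (K1 x y ^+ 2)%:E <= C1%:E)%E.
Hypothesis K2_bnd : forall x, A x -> (\int[mu]_(y in A) (K2 x y ^+ 2)%:E <= C2%:E)%E.
Variables (u v : X -> R) (w w' : X -> X -> R).
Hypothesis mw : measurable_fun AA (fun p => w p.1 p.2).
Hypothesis mw' : measurable_fun AA (fun p => w' p.1 p.2).
Hypothesis w1 : {ae mu2, forall p, AA p -> `|w p.1 p.2| <= 1}.
Hypothesis w'1 : {ae mu2, forall p, AA p -> `|w' p.1 p.2| <= 1}.
Hypothesis wN : {ae mu2, forall p, AA p -> w p.1 p.2 = - w p.2 p.1}.
Hypothesis w'N : {ae mu2, forall p, AA p -> w' p.1 p.2 = - w' p.2 p.1}.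
Hypothesis wu : {ae mu2, forall p, AA p -> dabs (u p.2 - u p.1) (w p.1 p.2)}.
Hypothesis w'v : {ae mu2, forall p, AA p -> dabs (v p.2 - v p.1) (w' p.1 p.2)}.
Variables Q h : X -> R.
Hypothesis mQ : measurable_fun A Q.
Hypothesis hL2 : sq_integrable mu A h.
Hypothesis QE : {ae mu, forall x, A x ->
  Q x = \int[mu]_(y in A) (K1 x y * w x y) -
        \int[mu]_(y in A) (K2 x y * w' x y) + h x}.

Let E x := \int[mu]_(y in A) (K1 x y * w x y) -
           \int[mu]_(y in A) (K2 x y * w' x y).
Let c : R := (1 + C1) + (1 + C2).

Let muAoo : (mu A < +oo)%E. Proof. by rewrite [X in (X < _)%E]muA; exact: ltry. Qed.

Let mE : measurable_fun A E.
Proof.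
apply: measurable_funB; first exact: (measurable_kernel_integral mu A mA muA K1 C1).
exact: (measurable_kernel_integral mu A mA muA K2 C2).
Qed.

Let E_bnd : {ae mu, forall x, A x -> `|E x| <= `|cst c x|}.
Proof.
apply: filterS2 (kernel_integral_bound mu A mA muA K1 C1 mK1 K1_ge0 K1_bnd w mw w1)
  (kernel_integral_bound mu A mA muA K2 C2 mK2 K2_ge0 K2_bnd w' mw' w'1)
  => x /[swap] h2 /[swap] Ax /(_ Ax) h1.
have {}h2 := h2 Ax.
apply: le_trans (ler_normB _ _) _; apply: le_trans (lerD h1 h2) _.
exact: ler_norm.
Qed.

Let EL2 : sq_integrable mu A E.
Proof. exact: (ae_le_sq_integrable mu A mA E (cst c) mE (sq_integrable_cst _ _ mA _ muAoo)). Qed.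

Let E_norm : norm2 mu A E <= `|c|.
Proof.
apply: le_trans (ae_le_norm2 mu A mA E (cst c) mE (sq_integrable_cst _ _ mA _ muAoo) E_bnd) _.
have -> : norm2 mu A (cst c) = `|c|; last by [].
have e : inner mu A (cst c) (cst c) = c ^+ 2 * fine (mu A).
  rewrite expr2; exact: (Rintegral_cst mu mA (c * c)).
by rewrite /norm2 e [X in fine X]muA/= mulr1 sqrtr_sqr.
Qed.

Let EhL2 : sq_integrable mu A (fun x => E x + h x).
Proof. exact: sq_integrableD. Qed.

Lemma slice_sq_integrable : sq_integrable mu A Q.
Proof.
apply: (ae_le_sq_integrable mu A mA Q (fun x => E x + h x)) => //.
by apply: filterS QE => x e /e ->.
Qed.

Lemma slice_norm2 : norm2 mu A Q <= `|c| + norm2 mu A h.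
Proof.
apply: (@le_trans _ _ (norm2 mu A (fun x => E x + h x))).
  by apply: ae_le_norm2 => //; apply: filterS QE => x e /e ->.
by apply: le_trans (norm2D _ _ mA _ _ EL2 hL2) _; rewrite lerD2r.
Qed.

Lemma slice_inner : sq_integrable mu A (fun x => u x - v x) ->
  inner mu A (fun x => u x - v x) Q <=
  norm2 mu A (fun x => u x - v x) *
    (norm2 mu2 AA (fun p => K1 p.1 p.2 - K2 p.1 p.2) + norm2 mu A h).
Proof.
move=> zL2.
have -> : inner mu A (fun x => u x - v x) Q =
    inner mu A (fun x => u x - v x) (fun x => E x + h x).
  have [mz _] := zL2; have [mEh _] := EhL2.
  by apply: ae_eq_inner => //; apply: aeW.
rewrite innerDr// mulrDr; apply: lerD.
  exact: (inner_kernel_le mu A mA muA K1 K2 C1 C2).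
exact: cauchy_schwarz_inner.
Qed.

End slice_estimate.

(** * Differences of solutions *)

Lemma measurable_cube (R : realType) n : measurable (@cube R n).
Proof.
elim: n => [|n IH] /=; first exact: measurable_itv.
by apply: measurableX => //; exact: measurable_itv.
Qed.

Lemma lebesgue_cube (R : realType) n : mm (leb_space R n) (@cube R n) = 1.
Proof.
have l01 : (@lebesgue_measure R) `[0%R, 1%R] = 1.
  by rewrite lebesgue_measure_itv/= lte_fin ltr01 oppr0 adde0.
elim: n => [|n IH] //=; rewrite /sfprod.
have -> := @product_measure1E _ _ _ _ R (@lebesgue_measure R) (mm (leb_space R n))
  `[0%R, 1%R] (@cube R n) (measurable_itv _) (measurable_cube R n).
by rewrite -[RHS]mule1; congr (_ * _); [exact: l01|exact: IH].
Qed.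

Section two_solutions.
Local Open Scope classical_set_scope.
Context {R : realType} {d : nat}.
Local Notation X := (@Rd R d).
Local Notation mu := (@lebd R d).
Local Notation Om := (@Omega R d).
Local Notation leb := (@lebesgue_measure R).
Variables (T : R) (T0 : (0 < T)%R).

Let mOm : measurable Om. Proof. exact: measurable_cube. Qed.
Let muOm : mu Om = 1. Proof. exact: lebesgue_cube. Qed.
Let mI (i : interval R) : measurable ([set` i] : set (measurableTypeR R)).
Proof. exact: measurable_itv. Qed.

(** The equation holds on the open time interval while the energy argument runs on the closed one;
    the two endpoints form a null set. *)
Let ae_open_itv : {ae leb, forall r, `[0%R, T] r -> `]0%R, T[ r}.
Proof.
exists ([set 0%R] `|` [set T]); split.
- by apply: measurableU; exact: measurable_set1.
- apply/eqP; rewrite -measure_le0.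
  apply: le_trans (measureU2 _ _ _) _; [exact: measurable_set1|exact: measurable_set1|].
  by rewrite /= !lebesgue_measure_set1 adde0.
move=> r /= /not_implyP[]; rewrite /= !in_itv/= => /andP[r0 rT] h.
have [->|r0'] := eqVneq r 0%R; first by left.
have [->|rT'] := eqVneq r T; first by right.
by exfalso; apply: h; rewrite !lt_neqAle eq_sym r0' r0 rT'.
Qed.

Section estimate.
Variables (K1 K2 : X -> X -> R) (f1 f2 : X -> R -> R) (g1 g2 : X -> R).
Variables (u1 u2 : X -> R -> R).
Hypothesis sol1 : solution1 K1 f1 g1 T u1.
Hypothesis sol2 : solution1 K2 f2 g2 T u2.
Hypotheses (aK1 : admissible_kernel K1) (aK2 : admissible_kernel K2).
Hypotheses (g1L2 : in_L2 g1) (g2L2 : in_L2 g2).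
Hypotheses (f1L : in_L1L2 T f1) (f2L : in_L1L2 T f2).

Let z x t := (u1 x t - u2 x t)%R.
Let h x t := (f1 x t - f2 x t)%R.
Let k := norm2 (mu \x mu) (Om `*` Om) (fun p => K1 p.1 p.2 - K2 p.1 p.2)%R.
Let psi r := norm2 mu Om (h^~ r).

Let mh : measurable_fun (Om `*` `[0%R, T]) (fun p => h p.1 p.2).
Proof. by have [mf1 _] := f1L; have [mf2 _] := f2L; exact: measurable_funB. Qed.

Let hL2 : {ae leb, forall r, `[0%R, T] r -> sq_integrable mu Om (h^~ r)}.
Proof.
have [mf1 i1] := f1L; have [mf2 i2] := f2L.
apply: filterS2 (ae_slice_sq_integrable mu Om mOm T f1 mf1 i1)
  (ae_slice_sq_integrable mu Om mOm T f2 mf2 i2) => r h1 h2 rT.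
exact: sq_integrableB (h1 rT) (h2 rT).
Qed.

Let ipsi : leb.-integrable `[0%R, T] (EFin \o psi).
Proof.
have [mf1 i1] := f1L; have [mf2 i2] := f2L.
have in1 := integrable_slice_norm2 mu Om mOm T f1 mf1 i1.
have in2 := integrable_slice_norm2 mu Om mOm T f2 mf2 i2.
apply: (ae_le_integrable leb _ (mI _) psi
  (fun r => norm2 mu Om (f1^~ r) + norm2 mu Om (f2^~ r))%R).
- exact: (measurable_slice_norm2 mu Om mOm T h).
- apply: filterS2 (ae_slice_sq_integrable mu Om mOm T f1 mf1 i1)
    (ae_slice_sq_integrable mu Om mOm T f2 mf2 i2) => r h1 h2 rT.
  rewrite ger0_norm; last exact: norm2_ge0.
  exact: norm2B (h1 rT) (h2 rT).
- exact: (integrableD (mI _) in1 in2).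
Qed.

Let sqK : sq_integrable (mu \x mu) (Om `*` Om) (fun p => K1 p.1 p.2 - K2 p.1 p.2)%R.
Proof.
have [mK1 _ _ [C1 hC1]] := aK1; have [mK2 _ _ [C2 hC2]] := aK2.
apply: sq_integrableB; first exact: measurableX.
  exact: (sq_integrable_kernel mu Om mOm muOm K1 C1).
exact: (sq_integrable_kernel mu Om mOm muOm K2 C2).
Qed.

Let gL2 : sq_integrable mu Om (fun x => g1 x - g2 x)%R.
Proof. exact: sq_integrableB. Qed.

Let mz t : (0 <= t)%R -> (t <= T)%R -> measurable_fun Om (z^~ t).
Proof.
move=> t0 tT; have ht : `[0%R, T] t by rewrite /= in_itv/= t0.
have [i1 _ _ _] := sol1; have [i2 _ _ _] := sol2.
apply: measurable_funB.
  by apply/measurable_EFinP; exact: measurable_int (i1 t ht).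
by apply/measurable_EFinP; exact: measurable_int (i2 t ht).
Qed.

Let z0g : {ae mu, forall x, Om x -> z x 0%R = (g1 x - g2 x)%R}.
Proof.
have [_ _ e1 _] := sol1; have [_ _ e2 _] := sol2.
by apply: filterS2 e1 e2 => x e1 e2 Ox; rewrite /z e1// e2.
Qed.

Let mz0 : measurable_fun Om (z^~ 0%R). Proof. exact: (mz _ (lexx _) (ltW T0)). Qed.

Let z0L2 : sq_integrable mu Om (z^~ 0%R).
Proof.
apply: (ae_le_sq_integrable mu Om mOm (z^~ 0%R) (fun x => g1 x - g2 x)%R) => //.
by apply: filterS z0g => x e /e ->.
Qed.

Let z0_norm : norm2 mu Om (z^~ 0%R) = norm2 mu Om (fun x => g1 x - g2 x)%R.
Proof.
have [mg _] := gL2; congr Num.sqrt; exact: ae_eq_inner.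
Qed.

Let energy t : (0 <= t)%R -> (t <= T)%R -> sq_integrable mu Om (z^~ t) /\
  (norm2 mu Om (z^~ t) <=
   norm2 mu Om (z^~ 0%R) + \int[leb]_(r in `[0%R, T]) psi r + T * k)%R.
Proof.
move=> t0 tT.
have [_ _ _ [v1 [eta1 [iv1 inc1 lap1 ve1]]]] := sol1.
have [_ _ _ [v2 [eta2 [iv2 inc2 lap2 ve2]]]] := sol2.
have [mK1 K10 K1s [C1 hC1]] := aK1; have [mK2 K20 K2s [C2 hC2]] := aK2.
(* The zero extension provides joint measurability up to the closed time interval, although v1 and
   v2 are controlled only inside. *)
pose q := (fun p => v1 p.1 p.2 - v2 p.1 p.2)%R \_ (Om `*` `]0%R, T[).
have mOI : measurable (Om `*` (`]0%R, T[ : set (measurableTypeR R))) by exact: measurableX.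
have qT : measurable_fun setT q.
  apply/(measurable_restrict _ mOI measurableT); rewrite setTI.
  apply: measurable_funB; apply/measurable_EFinP.
    exact: (measurable_int _ iv1).
  exact: (measurable_int _ iv2).
have mq : measurable_fun (Om `*` `[0%R, T]) q by exact: measurable_funTS.
have qE x r : Om x -> q (x, r) = ((v1 x \_ `]0%R, T[) r - (v2 x \_ `]0%R, T[) r)%R.
  move=> Ox; rewrite /q !patchE in_setX (mem_set Ox)/=.
  by case: ifPn => //; rewrite subr0.
have k0 : (0 <= k)%R by exact: norm2_ge0.
(* The sum of the two kernel bounds, enlarged by k to secure k <= c. *)
pose c := (`|1 + C1 + (1 + C2)| + k)%R.
have kc : (k <= c)%R by rewrite lerDr.
have qb : {ae leb, forall r, `[0%R, T] r ->
  [/\ sq_integrable mu Om (fun x => q (x, r)),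
      (norm2 mu Om (fun x => q (x, r)) <= c + psi r)%R &
      sq_integrable mu Om (z^~ r) ->
      (inner mu Om (z^~ r) (fun x => q (x, r)) <=
        norm2 mu Om (z^~ r) * (k + psi r))%R]}.
  (* The equation holds almost everywhere in space-time; it is turned into a statement for almost
     every time and then almost every x, to match the slicewise definition of the 1-Laplacian. *)
  have ve1' := ae_rect2 mu leb Om `]0%R, T[ _ ve1.
  have ve2' := ae_rect2 mu leb Om `]0%R, T[ _ ve2.
  apply: filterS3 (filterI lap1 lap2) (filterI ve1' ve2') (filterI hL2 ae_open_itv).
  move=> r /= [l1 l2] [e1 e2] [hr ro] rT.
  have {}ro := ro rT; have {}hr := hr rT.
  have {}e1 := e1 ro; have {}e2 := e2 ro.
  have [w1 [mw1 w11 w1N w1u w1e]] := l1 ro.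
  have [w2 [mw2 w21 w2N w2u w2e]] := l2 ro.
  have mQ : measurable_fun Om (fun x => q (x, r)).
    exact: (measurable_fun_pair2_rect Om `[0%R, T] mOm (mI _)).
  have QE : {ae mu, forall x, Om x ->
      q (x, r) = (\int[mu]_(y in Om) (K1 x y * w1 x y) -
        \int[mu]_(y in Om) (K2 x y * w2 x y) + h x r)%R}.
    apply: filterS2 (filterI e1 e2) (filterI w1e w2e) => x [ex1 ex2] [wx1 wx2] Ox.
    have ro' : r \in (`]0%R, T[ : set R) by rewrite inE.
    rewrite qE// !patchE ro' ex1// ex2//=.
    have -> : eta1 x r = (- \int[mu]_(y in Om) (K1 x y * w1 x y))%R.
      by have := congr1 fine (wx1 Ox); rewrite /= fineN.
    have -> : eta2 x r = (- \int[mu]_(y in Om) (K2 x y * w2 x y))%R.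
      by have := congr1 fine (wx2 Ox); rewrite /= fineN.
    by rewrite /h; ring.
  split.
  - exact: (slice_sq_integrable mu Om mOm muOm K1 K2 C1 C2 mK1 mK2 K10 K20
      hC1 hC2 w1 w2 mw1 mw2 w11 w21 _ _ mQ hr QE).
  - apply: le_trans (slice_norm2 mu Om mOm muOm K1 K2 C1 C2 mK1 mK2 K10 K20
      hC1 hC2 w1 w2 mw1 mw2 w11 w21 _ _ mQ hr QE) _.
    by rewrite /c lerD2r lerDl.
  - exact: (slice_inner mu Om mOm muOm K1 K2 C1 C2 mK1 mK2 K10 K20 K2s
      hC1 hC2 _ _ w1 w2 mw1 mw2 w11 w21 w1N w2N w1u w2u _ _ mQ hr QE).
have zq s t' : (0 <= s)%R -> (s <= t')%R -> (t' <= T)%R ->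
  {ae mu, forall x, Om x ->
    leb.-integrable `[s, t'] (fun r => (q (x, r))%:E) /\
    (z x t' - z x s = \int[leb]_(r in `[s, t']) q (x, r))%R}.
  move=> s0 st tT'.
  have i1 := solution_increment mu Om mOm T u1 v1 iv1 inc1 s t' s0 st tT'.
  have i2 := solution_increment mu Om mOm T u2 v2 iv2 inc2 s t' s0 st tT'.
  apply: filterS2 i1 i2 => x i1 i2 Ox.
  have [i1x e1] := i1 Ox; have [i2x e2] := i2 Ox.
  split.
    apply: eq_integrable (integrableB (mI _) i1x i2x) => // r _.
    by rewrite qE.
  have -> : (\int[leb]_(r in `[s, t']) q (x, r) = \int[leb]_(r in `[s, t'])
      ((v1 x \_ `]0%R, T[) r - (v2 x \_ `]0%R, T[) r))%R.
    by apply: eq_Rintegral => r _; exact: qE.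
  by rewrite RintegralB// -e1 -e2 /z; ring.
split.
  exact: (energy_sq_integrable mu Om mOm T z q psi k c T0 mz z0L2 mq
    (fun r => norm2_ge0 mu Om _) ipsi k0 kc qb zq).
exact: (energy_estimate mu Om mOm T z q psi k c T0 mz z0L2 mq
  (fun r => norm2_ge0 mu Om _) ipsi k0 kc qb zq).
Qed.

Lemma solution_diff_L2 t : `[0%R, T] t ->
  sq_integrable mu Om (fun x => u1 x t - u2 x t)%R.
Proof. by rewrite /= in_itv/= => /andP[t0 tT]; case: (energy t t0 tT). Qed.

Lemma solution_diff_estimate t : `[0%R, T] t ->
  L2norm (fun x => u1 x t - u2 x t)%R <=
    L2norm (fun x => g1 x - g2 x)%R
    + L1L2norm T (fun x t => f1 x t - f2 x t)%R
    + T%:E * L2norm2 (fun x y => K1 x y - K2 x y)%R.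
Proof.
move=> tT; have zL2 := solution_diff_L2 t tT.
move: tT; rewrite /= in_itv/= => /andP[t0 tT].
rewrite /L2norm /L2norm2 /L1L2norm /L2norm.
rewrite (norm2E mu Om mOm _ zL2) (norm2E mu Om mOm _ gL2).
rewrite (norm2E _ _ _ _ sqK); last exact: measurableX.
rewrite (integral_slice_norm2E mu Om mOm T h mh hL2).
rewrite (integrable_EFinK leb _ (mI _) psi ipsi) -z0_norm.
by rewrite -EFinM -!EFinD lee_fin; case: (energy t t0 tT).
Qed.

End estimate.

End two_solutions.

(** * Consequences *)

Lemma norm2_eq0_ae {d : measure_display} {X : measurableType d} {R : realType}
    (mu : {measure set X -> \bar R}) (D : set X) (f : X -> R) : measurable D ->
  sq_integrable mu D f -> norm2 mu D f = 0%R ->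
  {ae mu, forall x, D x -> f x = 0%R}.
Proof.
move=> mD fL2 f0; have [mf if2] := fL2.
have : \int[mu]_(x in D) `|(f x ^+ 2)%:E| = 0.
  under eq_integral do rewrite gee0_abs ?lee_fin ?sqr_ge0//.
  by rewrite integral_sqrE// f0 expr0n.
move/(ae_eq_integral_abs mu mD (measurable_int _ if2)).
apply: filterS => x e /e -[] /eqP; rewrite sqrf_eq0 => /eqP; exact.
Qed.

(** With y the square root of x this is y del <= del^2 + y^2. It replaces a square root by an
    expression affine in x, which can be integrated in time, and it remains valid at infinity. *)
Lemma poweR_half_le {R : realType} (del : R) (x : \bar R) : (0 < del)%R ->
  0 <= x -> x `^ 2^-1 <= del%:E + (del^-1)%:E * x.
Proof.
move=> del0; case: x => [x| |//]; last first.
  by move=> _; rewrite gt0_muley ?lte_fin ?invr_gt0// addey// leey.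
rewrite lee_fin => x0; rewrite poweR_EFin powR12_sqrt// -EFinM -EFinD lee_fin.
rewrite -{2}(sqr_sqrtr x0); set y := Num.sqrt x.
have y0 : (0 <= y)%R by exact: sqrtr_ge0.
rewrite -(ler_pM2r del0) mulrDl mulrAC mulVf ?gt_eqF// mul1r.
by have := sqr_ge0 (y - del)%R; rewrite !expr2; nra.
Qed.

Lemma cvge0_near_le {R : realType} (x : nat -> \bar R) : (forall n, 0 <= x n) ->
  (forall e : R, (0 < e)%R -> \forall n \near \oo, x n <= e%:E) ->
  x @ \oo --> 0.
Proof.
move=> x0 xe; apply/fine_cvgP; split.
  have := xe 1%R ltr01; apply: filterS => n xn.
  by rewrite ge0_fin_numE//; apply: le_lt_trans xn _; exact: ltry.
apply/cvgrPdist_le => e e0; have := xe e e0; apply: filterS => n xn.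
rewrite sub0r normrN ger0_norm ?fine_ge0// -lee_fin fineK//.
by rewrite ge0_fin_numE//; apply: le_lt_trans xn _; exact: ltry.
Qed.

(** * Convergence of the data in the norms of the estimate *)

Section vanishing.
Context {R : realType} {d : nat}.
Local Notation X := (@Rd R d).
Local Notation mu := (@lebd R d).
Local Notation Om := (@Omega R d).
Local Notation leb := (@lebesgue_measure R).

Let mOm : measurable Om. Proof. exact: measurable_cube. Qed.
Let muOm : mu Om = 1. Proof. exact: lebesgue_cube. Qed.

Let half_small (e : R) (x : \bar R) : (0 < e)%R -> 0 <= x ->
  x <= (e / 2 * (e / 2))%:E -> x `^ 2^-1 <= e%:E.
Proof.
move=> e0 x0 xe; have e20 : (0 < e / 2)%R by rewrite divr_gt0.
(* With del = e / 2 both terms of the affine bound are at most e / 2. *)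
apply: le_trans (poweR_half_le (e / 2) x e20 x0) _.
have -> : e%:E = (e / 2)%:E + (e / 2)%:E by rewrite -EFinD -splitr.
rewrite leeD2l//.
have -> : (e / 2)%:E = ((e / 2)^-1)%:E * (e / 2 * (e / 2))%:E.
  by rewrite -EFinM mulKf// gt_eqF.
by rewrite lee_pmul2l// lte_fin invr_gt0.
Qed.

Lemma L2norm_vanish (gn : nat -> X -> R) (g : X -> R) :
  (forall n, in_L2 (gn n)) -> in_L2 g ->
  {ae mu, forall x, Om x -> (fun n => gn n x) @ \oo --> g x} ->
  unif_integrable mu Om (fun n x => (gn n x ^+ 2)%R) ->
  forall e : R, (0 < e)%R ->
  \forall n \near \oo, L2norm (fun x => gn n x - g x)%R <= e%:E.
Proof.
move=> gnL2 [mg _] gng ui e e0.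
have muoo : mu Om < +oo by rewrite [X in X < _]muOm; exact: ltry.
have e20 : (0 < e / 2 * (e / 2))%R by rewrite mulr_gt0// divr_gt0.
have := vitali_sqr mu Om mOm gn g muoo (fun n => proj1 (gnL2 n)) mg gng ui _ e20.
apply: filterS => n; apply: half_small => //.
by apply: integral_ge0 => x _; rewrite lee_fin sqr_ge0.
Qed.

Lemma L2norm2_vanish (Kn : nat -> X -> X -> R) (K : X -> X -> R) :
  (forall n, admissible_kernel (Kn n)) -> admissible_kernel K ->
  {ae mu \x mu, forall p, (Om `*` Om) p ->
    (fun n => Kn n p.1 p.2) @ \oo --> K p.1 p.2} ->
  unif_integrable (mu \x mu) (Om `*` Om) (fun n p => (Kn n p.1 p.2 ^+ 2)%R) ->
  forall e : R, (0 < e)%R ->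
  \forall n \near \oo, L2norm2 (fun x y => Kn n x y - K x y)%R <= e%:E.
Proof.
move=> aKn [mK _ _ _] KnK ui e e0.
have mKn n : measurable_fun (Om `*` Om) (fun p => Kn n p.1 p.2) by case: (aKn n).
have mOO : measurable (Om `*` Om) by exact: measurableX.
have muoo : (mu \x mu) (Om `*` Om) < +oo.
  by rewrite product_measure1E// [X in X * _]muOm mul1e [X in X < _]muOm; exact: ltry.
have e20 : (0 < e / 2 * (e / 2))%R by rewrite mulr_gt0// divr_gt0.
have := vitali_sqr (mu \x mu) (Om `*` Om) mOO (fun n p => Kn n p.1 p.2)
  (fun p => K p.1 p.2) muoo mKn mK KnK ui _ e20.
apply: filterS => n; apply: half_small => //.
by apply: integral_ge0 => x _; rewrite lee_fin sqr_ge0.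
Qed.

(** Vitali makes the space-time integral of the squared difference small; the affine bound on the
    square root, integrated over [0, T], transfers this to the time integral of spatial norms. *)
Lemma L1L2norm_vanish (T : R) (fn : nat -> X -> R -> R) (f : X -> R -> R) :
  (0 < T)%R -> (forall n, in_L1L2 T (fn n)) -> in_L1L2 T f ->
  {ae mu \x leb, forall p, (Om `*` `[0%R, T]) p ->
    (fun n => fn n p.1 p.2) @ \oo --> f p.1 p.2} ->
  unif_integrable (mu \x leb) (Om `*` `[0%R, T]) (fun n p => (fn n p.1 p.2 ^+ 2)%R) ->
  forall e : R, (0 < e)%R ->
  \forall n \near \oo, L1L2norm T (fun x t => fn n x t - f x t)%R <= e%:E.
Proof.
move=> T0 fnL [mf _] fnf ui e e0.
have mfn n : measurable_fun (Om `*` `[0%R, T]) (fun p => fn n p.1 p.2) by case: (fnL n).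
have mI : measurable (`[0%R, T] : set (measurableTypeR R)) by exact: measurable_itv.
have lT : leb `[0%R, T] = T%:E by rewrite lebesgue_measure_itv/= lte_fin T0 -EFinB subr0.
have mOI : measurable (Om `*` (`[0%R, T] : set (measurableTypeR R))) by exact: measurableX.
have muoo : (mu \x leb) (Om `*` `[0%R, T]) < +oo.
  by rewrite product_measure1E// [X in X * _]muOm mul1e [X in X < _]lT; exact: ltry.
(* Chosen so that the constant del integrates to e / 2 over [0, T]; the target del * (e / 2) for
   Vitali then makes the other term at most e / 2. *)
pose del := (e / 2 / T)%R.
have del0 : (0 < del)%R by rewrite !divr_gt0.
have e20 : (0 < del * (e / 2))%R by rewrite mulr_gt0// divr_gt0.
have := vitali_sqr (mu \x leb) (Om `*` `[0%R, T]) mOI (fun n p => fn n p.1 p.2)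
  (fun p => f p.1 p.2) muoo mfn mf fnf ui _ e20.
apply: filterS => n hn.
pose F (p : X * R) := ((fn n p.1 p.2 - f p.1 p.2) ^+ 2)%:E.
have mF : measurable_fun (Om `*` `[0%R, T]) F.
  by apply/measurable_EFinP; apply: measurable_funX; exact: measurable_funB.
have F0 p : (Om `*` `[0%R, T]) p -> 0 <= F p by move=> _; rewrite lee_fin sqr_ge0.
rewrite (tonelli_rect2 mu leb Om `[0%R, T] mOm mI F mF F0) in hn.
have mG := measurable_tonelli_rect2 mu Om `[0%R, T] mOm mI F mF F0.
have G0 t : 0 <= \int[mu]_(x in Om) F (x, t).
  by apply: integral_ge0 => x _; rewrite lee_fin sqr_ge0.
apply: (@le_trans _ _ (\int[leb]_(t in `[0%R, T])
   (del%:E + (del^-1)%:E * \int[mu]_(x in Om) F (x, t)))).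
  apply: ge0_le_integral => //.
  - by move=> t _; exact: poweR_ge0.
  - exact: (measurableT_comp (measurable_poweR _) mG).
  - by apply: emeasurable_funD => //; exact: measurable_funeM.
  - by move=> t _; exact: (poweR_half_le del _ del0 (G0 t)).
rewrite ge0_integralD//; last 3 first.
- by move=> t _; rewrite lee_fin ltW.
- by move=> t _; rewrite mule_ge0// lee_fin invr_ge0 ltW.
- exact: measurable_funeM.
rewrite ge0_integralZl//; last by rewrite lee_fin invr_ge0 ltW.
have -> : \int[leb]_(t in `[0%R, T]) del%:E = (e / 2)%:E.
  have := integral_cst leb mI del%:E; rewrite /= => ->.
  by rewrite [X in _ * X]lT -EFinM /del divfK// gt_eqF.
have -> : e%:E = (e / 2)%:E + (e / 2)%:E by rewrite -EFinD -splitr.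
rewrite leeD2l//.
have -> : (e / 2)%:E = (del^-1)%:E * (del * (e / 2))%:E.
  by rewrite -EFinM mulKf// gt_eqF.
by rewrite lee_pmul2l// lte_fin invr_gt0.
Qed.

End vanishing.

Section consequences.
Context {R : realType} {d : nat}.
Local Notation X := (@Rd R d).
Local Notation mu := (@lebd R d).
Local Notation Om := (@Omega R d).
Variables (T : R) (T0 : (0 < T)%R).

(** The difference estimate with the same kernel and data on both sides has right-hand side 0. *)
Lemma solution_unique (K : X -> X -> R) (f : X -> R -> R) (g : X -> R)
    (u w : X -> R -> R) :
  solution1 K f g T u -> solution1 K f g T w ->
  admissible_kernel K -> in_L2 g -> in_L1L2 T f ->
  forall t, `[0%R, T] t -> {ae mu, forall x, Om x -> w x t = u x t}.
Proof.
move=> su sw aK gL fL t tT.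
have zL2 := solution_diff_L2 T T0 K K f f g g w u sw su aK aK gL gL fL fL t tT.
have := solution_diff_estimate T T0 K K f f g g w u sw su aK aK gL gL fL fL t tT.
have L20 : L2norm (fun x : X => g x - g x)%R = 0.
  rewrite /L2norm integral0_eq ?poweR0r ?invr_eq0 ?pnatr_eq0//.
  by move=> x _; rewrite subrr expr0n.
have L220 : L2norm2 (fun x y : X => K x y - K x y)%R = 0.
  rewrite /L2norm2 integral0_eq ?poweR0r ?invr_eq0 ?pnatr_eq0//.
  by move=> x _; rewrite subrr expr0n.
have L1L20 : L1L2norm T (fun (x : X) t => f x t - f x t)%R = 0.
  rewrite /L1L2norm; apply: integral0_eq => s _.
  rewrite /L2norm integral0_eq ?poweR0r ?invr_eq0 ?pnatr_eq0//.
  by move=> x _; rewrite subrr expr0n.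
rewrite L20 L220 L1L20 mule0 !adde0 /L2norm.
rewrite (norm2E mu Om (measurable_cube R d.-1) _ zL2) lee_fin => n0.
have {}n0 : norm2 mu Om (fun x => w x t - u x t)%R = 0%R.
  by apply/eqP; rewrite eq_le n0 norm2_ge0.
have := norm2_eq0_ae mu Om _ (measurable_cube R d.-1) zL2 n0.
by apply: filterS => x e /e /eqP; rewrite subr_eq0 => /eqP.
Qed.

Lemma CL2norm_ge0 (w : X -> R -> R) : 0 <= CL2norm T w.
Proof.
apply: (@le_trans _ _ (L2norm (fun x => w x 0%R))); first exact: poweR_ge0.
by apply: ereal_sup_ubound; exists 0%R => //=; rewrite in_itv/= lexx ltW.
Qed.

End consequences.

Theorem theorem5p5 (R : realType) (d : nat) (hd : (1 <= d)%N) (T : R)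
  (hT : (0 < T)%R)
  (K : Rd R d -> Rd R d -> R) (f : Rd R d -> R -> R) (g : Rd R d -> R)
  (u : Rd R d -> R -> R)
  (Kn : nat -> Rd R d -> Rd R d -> R) (fn : nat -> Rd R d -> R -> R)
  (gn : nat -> Rd R d -> R) (un : nat -> Rd R d -> R -> R) :
  @solution1 R d K f g T u ->
  (forall n, @solution1 R d (Kn n) (fn n) (gn n) T (un n)) ->
  @admissible_kernel R d K -> (forall n, @admissible_kernel R d (Kn n)) ->
  @in_L2 R d g -> (forall n, @in_L2 R d (gn n)) ->
  @in_L1L2 R d T f -> (forall n, @in_L1L2 R d T (fn n)) ->
  [/\
   (* (i) uniqueness, as elements of C([0,T]; L^1(Omega)) *)
   (forall w, @solution1 R d K f g T w -> forall t, `[0%R, T] t ->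
      {ae @lebd R d, forall x, @Omega R d x -> w x t = u x t}) /\
   (forall n w, @solution1 R d (Kn n) (fn n) (gn n) T w -> forall t,
      `[0%R, T] t ->
      {ae @lebd R d, forall x, @Omega R d x -> w x t = un n x t}),
   (* (ii) stability estimate *)
   (forall n,
      @CL2norm R d T (fun x t => un n x t - u x t)%R <=
        @L2norm R d (fun x => gn n x - g x)%R
        + @L1L2norm R d T (fun x t => fn n x t - f x t)%R
        + T%:E * @L2norm2 R d (fun x y => Kn n x y - K x y)%R) &
   (* (iii) convergence *)
   ({ae (@lebd R d \x @lebd R d), forall p, (@Omega R d `*` @Omega R d) p ->
        (fun n => Kn n p.1 p.2) @ \oo --> K p.1 p.2} ->
    {ae @lebd R d, forall x, @Omega R d x -> (fun n => gn n x) @ \oo --> g x} ->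
    {ae (@lebd R d \x @lebesgue_measure R), forall p,
        (@Omega R d `*` `[0%R, T]) p ->
        (fun n => fn n p.1 p.2) @ \oo --> f p.1 p.2} ->
    unif_integrable (@lebd R d \x @lebd R d) (@Omega R d `*` @Omega R d)
      (fun n p => (Kn n p.1 p.2 ^+ 2)%R) ->
    unif_integrable (@lebd R d) (@Omega R d) (fun n x => (gn n x ^+ 2)%R) ->
    unif_integrable (@lebd R d \x @lebesgue_measure R)
      (@Omega R d `*` `[0%R, T]) (fun n p => (fn n p.1 p.2 ^+ 2)%R) ->
    (fun n => @CL2norm R d T (fun x t => un n x t - u x t)%R) @ \oo --> 0)].
Proof.
move=> su sun aK aKn gL gnL fL fnL.
(* The right-hand side is independent of t, so it bounds the supremum over [0, T]. *)
have est n : CL2norm T (fun x t => un n x t - u x t)%R <=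
    L2norm (fun x => gn n x - g x)%R
    + L1L2norm T (fun x t => fn n x t - f x t)%R
    + T%:E * L2norm2 (fun x y => Kn n x y - K x y)%R.
  apply: ub_ereal_sup => _ [t tT <-].
  exact: (solution_diff_estimate T hT (Kn n) K (fn n) f (gn n) g (un n) u).
split; [split| |] => //.
- by move=> w sw; exact: (solution_unique T hT K f g u w).
- by move=> n w sw; exact: (solution_unique T hT (Kn n) (fn n) (gn n) (un n) w).
move=> cK cg cf uK ug uf.
apply: cvge0_near_le => [n|e e0]; first exact: CL2norm_ge0.
have e30 : (0 < e / 3)%R by rewrite divr_gt0.
(* The extra division by T compensates the factor T in front of the kernel norm. *)
have eT0 : (0 < e / 3 / T)%R by rewrite divr_gt0.
apply: filterS3 (L2norm_vanish gn g gnL gL cg ug _ e30)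
  (L1L2norm_vanish T fn f hT fnL fL cf uf _ e30)
  (L2norm2_vanish Kn K aKn aK cK uK _ eT0) => n gne fne Kne.
apply: le_trans (est n) _.
have -> : e%:E = (e / 3)%:E + (e / 3)%:E + T%:E * (e / 3 / T)%:E.
  rewrite -EFinM -!EFinD; congr EFin; field; exact: lt0r_neq0.
by apply: leeD; [exact: leeD|rewrite lee_pmul2l].
Qed.
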